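(* Let $\lambda>0$, let $N=(N_t)_{t\ge 0}$ be a Poisson process with constant intensity $\lambda$, and let $W_t$ be the total time up to $t$ spent in record lifetimes (defined in the context). Then, as $t\to\infty$, $$\frac{1}{(\log t)^{3/2}}\left(W_t-\frac{(\log t)^2}{2\lambda}\right)\xrightarrow{d} W',$$ where $W'$ has a normal distribution with mean $0$ and variance $1/(3\lambda^2)$.
   Context: Let $(X_k)_{k\in\mathbb{N}}$ be independent random variables on a probability space $(\Omega,\mathcal{A},P)$, each exponentially distributed with parameter $\lambda>0$, i.e. $P(X_k\le x)=1-e^{-\lambda x}$ for $x\ge 0$. Put $S_0=0$, $S_n=\sum_{k=1}^n X_k$ for $n\ge 1$, and $N_t=\sup\{n\in\mathbb{N}_0: S_n\le t\}$ for $t\ge 0$; this is the Poisson process with inter-arrival times $X_k$. Define the record indicators by $I_1=1$ and $I_n=\prod_{k=1}^{n-1}1_{\{X_n>X_k\}}$ for $n\ge 2$. For $t\ge 0$ put $$W_t=\int_0^t I_{N_s+1}\,ds=\mathrm{Leb}(\{0\le s\le t: I_{N_s+1}=1\}).$$ $\xrightarrow{d}$ denotes convergence in distribution. *)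

(* Defs.v *)
From HB Require Import structures.
From mathcomp Require Import all_boot all_order all_algebra.
From mathcomp Require Import finmap.
From mathcomp Require Import all_classical all_reals all_analysis.
From mathcomp Require Import measurable_realfun.

Set Implicit Arguments.
Unset Strict Implicit.
Unset Printing Implicit Defensive.

Import Order.TTheory GRing.Theory Num.Theory.
Import numFieldNormedType.Exports.

Local Open Scope classical_set_scope.
Local Open Scope ring_scope.

Definition mutually_independent (R : realType) (d : measure_display)
    (T : measurableType d) (P : probability T R) (I : choiceType)
    (X : I -> {RV P >-> R}) : Prop :=
  forall (J : {fset I}) (B : I -> set R), (forall i, measurable (B i)) ->
    P (\bigcap_(i in [set` J]) (X i @^-1` B i)) =
    (\prod_(i <- J) P (X i @^-1` B i))%E.

(* The equality is restricted to measurable sets because the library's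
   measures are total functions, with unspecified values elsewhere. *)
Definition has_law (R : realType) (d : measure_display)
    (T : measurableType d) (P : probability T R) (X : {RV P >-> R})
    (mu : set R -> \bar R) : Prop :=
  forall B : set R, measurable B -> distribution P X B = mu B.

(* The limit variable may live on a different probability space. *)
Definition cvg_in_distribution (R : realType) (d d' : measure_display)
    (T : measurableType d) (T' : measurableType d')
    (P : probability T R) (P' : probability T' R)
    (I : Type) (F : set_system I)
    (Z : I -> {RV P >-> R}) (Y : {RV P' >-> R}) : Prop :=
  forall x : R, {for x, continuous (cdf Y)} ->
    cdf (Z i) x @[i --> F] --> cdf Y x.

Section record_process.
Context (R : realType) (d : measure_display) (T : measurableType d)
  (P : probability T R).

(* Sequences are indexed from 0: X n is the (n+1)-st inter-arrival time. *)
Implicit Types X : nat -> {RV P >-> R}.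

Definition arrival_time X (n : nat) (w : T) : R := \sum_(k < n) X k w.

(* The supremum is 0 by convention on the event that the set is unbounded,
   which is negligible when the inter-arrival times are independent and
   exponentially distributed. *)
Definition counting_process X (t : R) (w : T) : nat :=
  supremum 0%N [set n : nat | arrival_time X n w <= t].

(* With indices starting at 0, this is the indicator that the (n+1)-st
   inter-arrival time is a record; it is 1 for n = 0. *)
Definition record_indicator X (n : nat) (w : T) : R :=
  \prod_(k < n) \1_[set v | X k v < X n v] w.

Definition record_time X (t : R) (w : T) : R :=
  \int[lebesgue_measure]_(s in `[0, t])
    record_indicator X (counting_process X s w) w.

Lemma measurable_arrival_time X n : measurable_fun setT (arrival_time X n).
Proof. exact: measurable_sum. Qed.

Lemma measurable_record_indicator X n :
  measurable_fun setT (record_indicator X n).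
Proof.
apply: measurable_prod => k _; apply: measurable_indic.
rewrite -[X in measurable X]setTI.
exact: (@measurable_fun_ltr _ _ _ setT (X k) (X n) _ _ measurableT [set true]).
Qed.

Lemma counting_processE X t w n : (counting_process X t w = n) <->
  (supremums [set m | arrival_time X m w <= t] n \/
   (n = 0%N /\ forall m, ~ supremums [set m | arrival_time X m w <= t] m)).
Proof.
rewrite /counting_process /supremum.
set A := [set m | _]; case: ifPn => [/eqP A0|_].
  rewrite A0; have s0 : supremums (@set0 nat) 0%N.
    by split => // m _; exact: leq0n.
  split=> [<-|[[_ n0]|[-> //]]]; first by left.
  by apply/eqP; rewrite eq_sym -leqn0; exact: (n0 0%N).
case: xgetP => [y _ sy|sN].
- split=> [<-|[sn|[_ /(_ _ sy)//]]]; first by left.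
  exact: (is_subset1_supremums sy sn).
- split=> [<-|[/sN//|[-> //]]]; by right.
Qed.

Lemma measurable_counting_process X (n : nat) :
  measurable [set p : T * R | counting_process X p.2 p.1 = n].
Proof.
pose B m := [set p : T * R | arrival_time X m p.1 <= p.2].
have mB m : measurable (B m).
  rewrite -[X in measurable X]setTI; apply: measurable_fun_le => //.
  by apply: measurableT_comp => //; exact: measurable_arrival_time.
pose U m := \bigcap_(k in [set k | (m < k)%N]) ~` B k.
have UE m p : U m p <-> ubound [set k | arrival_time X k p.1 <= p.2] m.
  split=> [Up k Bk|ub k /= mk Bk].
    by rewrite leNgt; apply/negP => mk; exact: (Up k mk).
  by have := ub k Bk; rewrite leNgt => /negP; apply.
have mU m : measurable (U m).
  by apply: bigcap_measurableType => k _; exact: measurableC.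
pose V m := U m `&` \bigcap_(k in [set k | (k < m)%N]) ~` U k.
have VE m p : V m p <-> supremums [set k | arrival_time X k p.1 <= p.2] m.
  split=> [[/UE ? Vp]|[/UE ? lb]].
    split=> // k /UE Uk; rewrite leNgt; apply/negP => km; exact: (Vp k km).
  split=> // k /= km /UE Uk; have := lb k Uk.
  by rewrite leNgt => /negP; apply.
have mV m : measurable (V m).
  apply: measurableI => //.
  by apply: bigcap_measurableType => k _; exact: measurableC.
have -> : [set p : T * R | counting_process X p.2 p.1 = n] =
    V n `|` ([set p | n = 0%N] `&` \bigcap_m ~` V m).
  apply/seteqP; split=> p /=.
    move/counting_processE => -[/VE|[n0 Vp]]; first by left.
    by right; split=> // m _ /VE; exact: Vp.
  move=> H; apply/counting_processE; case: H => [/VE|[n0 Vp]]; first by left.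
  by right; split=> // m /VE; exact: (Vp m I).
apply: measurableU => //; apply: measurableI.
  by case: (pselect (n = 0%N)) => [n0|n0];
    [rewrite (_ : mkset _ = setT)//|rewrite (_ : mkset _ = set0)//];
    apply/seteqP; split.
by apply: bigcap_measurableType => k _; exact: measurableC.
Qed.

Lemma measurable_record_indicator_counting_process X :
  measurable_fun setT
    (fun p : T * R => record_indicator X (counting_process X p.2 p.1) p.1).
Proof.
move=> _ Y mY; rewrite setTI.
rewrite (_ : _ @^-1` _ =
    \bigcup_n ([set p : T * R | counting_process X p.2 p.1 = n] `&`
      (record_indicator X n \o fst) @^-1` Y)).
  apply: bigcupT_measurable => n; apply: measurableI.
    exact: measurable_counting_process.
  rewrite -[X in measurable X]setTI.
  have : measurable_fun [set: T * R] (record_indicator X n \o fst).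
    by apply: measurableT_comp => //; exact: measurable_record_indicator.
  exact.
apply/seteqP; split=> p /=; first by exists (counting_process X p.2 p.1).
by move=> [n _ /= [-> ]].
Qed.

Lemma record_indicator_ge0 X n w : 0 <= record_indicator X n w.
Proof. by apply: prodr_ge0 => k _; rewrite indicE. Qed.

Lemma measurable_record_time X t : measurable_fun setT (record_time X t).
Proof.
rewrite /record_time /Rintegral; apply: measurableT_comp => //.
pose f (p : T * R) :=
  ((record_indicator X (counting_process X p.2 p.1) p.1)%:E *
   (\1_(`[0, t]%classic : set R) p.2)%:E)%E.
rewrite (_ : (fun w => _) =
    (fun w => (\int[lebesgue_measure]_s f (w, s))%E)); last first.
  apply/funext => w; rewrite integral_mkcond; apply: eq_integral => s _.
  by rewrite /f epatch_indic.
apply: measurable_fun_fubini_tonelli_F.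
  apply: emeasurable_funM; apply/measurable_EFinP.
    exact: measurable_record_indicator_counting_process.
  have mI : measurable_fun [set: R] (\1_`[0, t] : R -> R).
    exact: measurable_indic.
  exact: (measurableT_comp mI measurable_snd).
by move=> p; rewrite mule_ge0 ?lee_fin ?record_indicator_ge0// indicE.
Qed.

HB.instance Definition _ X t :=
  isMeasurableFun.Build _ _ T R (record_time X t) (measurable_record_time X t).

End record_process.

Definition center_scale (R : realType) (T : Type) (c s : R) (Y : T -> R)
  (w : T) : R := s^-1 * (Y w - c).

Section center_scale_measurable.
Context (R : realType) (d : measure_display) (T : measurableType d).

Lemma measurable_center_scale (c s : R) (Y : {mfun T >-> R}) :
  measurable_fun setT (center_scale c s Y).
Proof. by apply: measurable_funM => //; exact: measurable_funB. Qed.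

HB.instance Definition _ (c s : R) (Y : {mfun T >-> R}) :=
  isMeasurableFun.Build _ _ T R (center_scale c s Y)
    (measurable_center_scale c s Y).

End center_scale_measurable.

(* Main.v *)
Require Import Defs.
From HB Require Import structures.
From mathcomp Require Import all_boot all_order all_algebra.
From mathcomp Require Import finmap.
From mathcomp Require Import all_classical all_reals all_analysis.
From mathcomp Require Import measurable_realfun.
From mathcomp Require Import ring lra.
Import Order.TTheory GRing.Theory Num.Theory.
Import numFieldNormedType.Exports.
Local Open Scope classical_set_scope.
Local Open Scope ring_scope.

Set Implicit Arguments.
Unset Strict Implicit.
Unset Printing Implicit Defensive.

(** Write S_n for the arrival times, V_n for the sum of the first n lifetimes
    that are records, and A(m) for the sum of all record values that do not
    exceed a level m.  Three facts give the theorem.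

    - W_t lies between V_n and V_n' as soon as S_n <= t < S_n', because the
      integrand is constant, equal to the record indicator of the n-th
      lifetime, between two consecutive arrivals.  As V is nondecreasing, very
      crude bounds on the number of arrivals are enough: changing t by a factor
      exp (o (sqrt (ln t))) changes (ln t)^2 by o ((ln t)^(3/2)).

    - With high probability, V_n in turn lies between A(m) and A(m'), where m and
      m' are slightly below and slightly above (ln n) / lambda, since the maximum
      of n exponential variables concentrates there.

    - The record values of exponential variables form a Poisson process, so
      A(m) has the compound Poisson law with
      E exp (i theta A(m)) = exp (lambda int_0^m (exp (i theta x) - 1) dx),
      mean lambda m^2 / 2 and variance lambda m^3 / 3.  With m = (ln t) / lambda
      this is the claimed centring, and the claimed variance after scaling by
      (ln t)^(3/2).

    The formula for the characteristic function is proved by a martingale: the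
    pair (running maximum, sum of the
    records so far) is a Markov chain driven by the lifetimes, and
    exp (i theta v + lambda int_y^m (exp (i theta x) - 1) dx), at maximum y and
    partial sum v, has constant expectation along it
    (record_step_final_cos, expectation_record_chain_final_cos).  Everything is
    stated for the real part, with an arbitrary phase b in place of complex
    numbers.  The Markov property is chain_decoupling.

    Convergence of these cosine transforms yields convergence of distribution
    functions (levy_cdf).  The smoothing kernel there is the Cauchy kernel: it
    is the cosine transform of an exponential law, and its primitive is an
    arctangent, so that both its Fourier representation and its concentration
    are explicit.

    For the asymptotics the parameter is sg = (ln t)^(1/4), so that all the
    powers of ln t are powers of sg; the levels are (sg^4 +- 2 sg) / lambda and
    the numbers of lifetimes exp (sg^4 +- sg). *)

(** * Bounded functions on probability spaces *)

Section bounded_integrals.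
Context (R : realType) d (T : measurableType d).
Implicit Types (f g : T -> R).

Lemma bounded_integrable (mu : {finite_measure set T -> \bar R}) f (K : R) :
  measurable_fun setT f -> (forall x, `|f x| <= K) ->
  mu.-integrable setT (EFin \o f).
Proof.
move=> mf fK; apply: measurable_bounded_integrable => //.
  exact: fin_num_fun_lty (fin_num_measure mu).
exists K; split; first exact: num_real.
by move=> M KM x _; exact: le_trans (fK x) (ltW KM).
Qed.

Lemma bounded_EFin_Rintegral (mu : {finite_measure set T -> \bar R}) f (K : R) :
  measurable_fun setT f -> (forall x, `|f x| <= K) ->
  (\int[mu]_x f x)%:E = (\int[mu]_x (f x)%:E)%E.
Proof.
move=> mf fK; rewrite fineK//; apply: integrable_fin_num => //.
exact: bounded_integrable fK.
Qed.

Lemma Rintegral_prob_cst (P : probability T R) (c : R) : \int[P]_x c = c.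
Proof.
rewrite Rintegral_cst//.
by have := probability_setT P; move=> /= ->; rewrite mulr1.
Qed.

Lemma bounded_cvg_Rintegral (P : probability T R) (f_ : nat -> T -> R) f (K : R) :
  (forall n, measurable_fun setT (f_ n)) ->
  (forall n x, `|f_ n x| <= K) ->
  (forall x, f_ n x @[n --> \oo] --> f x) ->
  \int[P]_x f_ n x @[n --> \oo] --> \int[P]_x f x.
Proof.
move=> mf fK cf; apply: fine_cvg.
have mlim : measurable_fun setT f.
  by apply: (measurable_fun_cvg (h := f_)) => // x _; exact: cf.
have fK' x : `|f x| <= K.
  have /cvg_norm h := cf x; apply: (cvgr_to_le h); exact: nearW.
rewrite (bounded_EFin_Rintegral P mlim fK').
apply: (@dominated_cvg _ _ _ P _ measurableT _ _ (cst K%:E)) => //.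
- by move=> n; exact/measurable_EFinP.
- by move=> x _; apply: cvg_EFin; [exact: nearW|exact: cf].
- apply: (@bounded_integrable P (cst K) `|K|) => //.
- by move=> n x _; rewrite /= lee_fin.
Qed.

End bounded_integrals.

Lemma bounded_norm_Rintegral (R : realType) d (T : measurableType d)
    (P : probability T R) (f : T -> R) (K : R) :
  measurable_fun setT f -> (forall x, `|f x| <= K) -> `|\int[P]_x f x| <= K.
Proof.
move=> mf fK; have If := bounded_integrable P mf fK.
apply: le_trans (le_normr_Rintegral measurableT If) _.
rewrite -[leRHS](Rintegral_prob_cst P); apply: le_Rintegral => //.
  apply: (@bounded_integrable _ _ _ P _ K) => [|x]; last by rewrite normr_id.
  exact: measurableT_comp.
by apply: (@bounded_integrable _ _ _ P (cst K) `|K|).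
Qed.

Section bounded_fubini.
Context (R : realType) d1 d2 (T1 : measurableType d1) (T2 : measurableType d2).
Variables (P1 : probability T1 R) (P2 : probability T2 R).

Lemma measurable_Rintegral_section (f : T1 * T2 -> R) (K : R) :
  measurable_fun setT f -> (forall x, `|f x| <= K) ->
  measurable_fun setT (fun x => \int[P2]_y f (x, y)).
Proof.
move=> mf fK; apply: measurableT_comp => //.
apply: (@measurable_fubini_F _ _ _ _ _ P1 P2 (EFin \o f)).
exact: (@bounded_integrable _ _ _ ((P1 \x P2)%E : probability (T1 * T2)%type R) f K).
Qed.

Lemma bounded_Fubini (f : T1 * T2 -> R) (K : R) :
  measurable_fun setT f -> (forall x, `|f x| <= K) ->
  \int[P1]_x \int[P2]_y f (x, y) = \int[P2]_y \int[P1]_x f (x, y).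
Proof.
move=> mf fK; rewrite /Rintegral; congr fine.
have := @Fubini _ _ _ _ _ P1 P2 (EFin \o f)
  (@bounded_integrable _ _ _ ((P1 \x P2)%E : probability (T1 * T2)%type R) f K mf fK).
rewrite /=.
under eq_integral => x _.
  rewrite -(@bounded_EFin_Rintegral _ _ _ P2 (fun y => f (x, y)) K)//.
  over.
  exact: measurableT_comp mf (pair1_measurable x).
move=> ->; apply: eq_integral => y _.
rewrite -(@bounded_EFin_Rintegral _ _ _ P1 (fun x => f (x, y)) K)//.
exact: measurableT_comp mf (pair2_measurable y).
Qed.

End bounded_fubini.

Section density.
Context (R : realType) d (T : measurableType d).
Variables (mu : {measure set T -> \bar R}) (nu : {measure set T -> \bar R}).
Variable p : T -> R.
Hypothesis mp : measurable_fun setT p.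
Hypothesis p0 : forall x, 0 <= p x.
Hypothesis nuE : forall A, measurable A -> nu A = (\int[mu]_(x in A) (p x)%:E)%E.

Import HBNNSimple.

(** Both sides agree on indicators, hence on simple functions, and monotone
    convergence does the rest. *)
Lemma ge0_integral_density (f : T -> \bar R) :
  measurable_fun setT f -> (forall x, 0 <= f x)%E ->
  (\int[nu]_x f x = \int[mu]_x (f x * (p x)%:E))%E.
Proof.
move=> mf f0; pose f_ := nnsfun_approx measurableT mf.
have mf_ n : measurable_fun setT (EFin \o f_ n) by exact/measurable_EFinP.
have mEp : measurable_fun setT (EFin \o p) by exact/measurable_EFinP.
have nd a b : (a <= b)%N -> forall x, f_ a x <= f_ b x.
  by move=> ab x; exact/lefP/nd_nnsfun_approx.
have f_f x : (f_ n x)%:E @[n --> \oo] --> f x.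
  by apply: cvg_nnsfun_approx => //.
have step n : (\int[nu]_x (f_ n x)%:E = \int[mu]_x ((f_ n x)%:E * (p x)%:E))%E.
  under [LHS]eq_integral do rewrite fimfunE -fsumEFin//.
  rewrite [LHS]ge0_integral_fsum//; last 2 first.
    by move=> r; exact/measurable_EFinP/measurableT_comp.
    by move=> r x _; rewrite EFinM nnfun_muleindic_ge0.
  transitivity (\int[mu]_x \sum_(r \in range (f_ n))
      ((r * \1_(f_ n @^-1` [set r]) x)%:E * (p x)%:E))%E; last first.
    apply: eq_integral => x _; rewrite fimfunE -fsumEFin// ge0_mule_fsuml//.
    by move=> r; rewrite EFinM nnfun_muleindic_ge0.
  rewrite [RHS]ge0_integral_fsum//; last 2 first.
    by move=> r; apply: emeasurable_funM => //; exact/measurable_EFinP/measurableT_comp.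
    by move=> r x _; rewrite mule_ge0 ?lee_fin// -lee_fin EFinM nnfun_muleindic_ge0.
  apply: eq_fsbigr => r _.
  have mr : measurable (f_ n @^-1` [set r]) by [].
  rewrite integralZl_indic_nnsfun// integral_indic// setIT nuE//.
  under [RHS]eq_integral do rewrite EFinM -muleA.
  have [r0|r0] := leP 0 r.
    rewrite ge0_integralZl//; last 2 first.
      by apply: emeasurable_funM => //; exact/measurable_EFinP.
      by move=> x _; rewrite mule_ge0// lee_fin.
    congr *%E; rewrite integral_mkcond; apply: eq_integral => x _.
    by rewrite patchE indicE; case: ifP => _; rewrite ?mul1e ?mul0e.
  rewrite (_ : f_ n @^-1` [set r] = set0) ?integral_set0 ?mule0.
    by rewrite integral0_eq// => x _; rewrite indic0/= mul0e mule0.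
  rewrite -subset0 => x /= xr; have : 0 <= f_ n x by [].
  by rewrite xr leNgt r0.
transitivity (limn (fun n => \int[nu]_x (f_ n x)%:E)%E).
  rewrite -monotone_convergence//=.
  - by apply: eq_integral => x _; apply/esym/cvg_lim => //; exact: f_f.
  - by move=> n x _; rewrite lee_fin.
  - by move=> x _ a b ab; rewrite lee_fin; exact: nd.
transitivity (limn (fun n => \int[mu]_x ((f_ n x)%:E * (p x)%:E))%E).
  by apply: congr_lim; apply/funext => n; exact: step.
rewrite -monotone_convergence//=.
- apply: eq_integral => x _; apply/cvg_lim => //.
  exact: (@cvgeZr nat \oo R _ (f x) (p x)%:E isT (f_f x)).
- by move=> n; exact: emeasurable_funM (mf_ n) mEp.
- by move=> n x _; rewrite mule_ge0// lee_fin.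
- by move=> x _ a b ab; rewrite lee_pmul// lee_fin//; exact: nd.
Qed.

End density.

Section bounded_density.
Context (R : realType) d (T : measurableType d).
Variables (mu : {measure set T -> \bar R}) (nu : probability T R).
Variable p : T -> R.
Hypothesis mp : measurable_fun setT p.
Hypothesis p0 : forall x, 0 <= p x.
Hypothesis nuE : forall A, measurable A -> nu A = (\int[mu]_(x in A) (p x)%:E)%E.

Lemma density_integrable : mu.-integrable setT (EFin \o p).
Proof.
apply/integrableP; split; first exact/measurable_EFinP.
under eq_integral do rewrite /= ger0_norm//.
rewrite -nuE//.
by have := probability_setT nu; move=> /= ->; rewrite ltry.
Qed.

Lemma integral_density1 : \int[mu]_x p x = 1.
Proof.
rewrite /Rintegral -nuE//.
by have := probability_setT nu; move=> /= ->.
Qed.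

Lemma bounded_density_integrable (f : T -> R) (K : R) :
  measurable_fun setT f -> (forall x, `|f x| <= K) ->
  mu.-integrable setT (EFin \o (fun x => f x * p x)).
Proof.
move=> mf fK.
rewrite [X in integrable _ _ X](_ : _ = (EFin \o f) \* (EFin \o p))%E//.
apply: integrableMr => //; last exact: density_integrable.
exists K; split; first exact: num_real.
by move=> M KM x _; exact: le_trans (fK x) (ltW KM).
Qed.

(** Shifting f by its bound K reduces the signed case to the nonnegative one. *)
Lemma bounded_Rintegral_density (f : T -> R) (K : R) :
  measurable_fun setT f -> (forall x, `|f x| <= K) ->
  \int[nu]_x f x = \int[mu]_x (f x * p x).
Proof.
move=> mf fK.
have f_ge x : 0 <= f x + K by have := fK x; rewrite ler_norml => /andP[]; lra.
have mfK : measurable_fun setT (fun x => (f x + K)%:E).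
  by apply/measurable_EFinP; exact: measurable_funD.
have h : \int[nu]_x (f x + K) = \int[mu]_x (f x * p x + K * p x).
  rewrite /Rintegral (ge0_integral_density mp p0 nuE mfK) => [|x]; last first.
    by rewrite lee_fin.
  by congr fine; apply: eq_integral => x _; rewrite -EFinM; congr EFin; ring.
move: h.
rewrite RintegralD//; last 2 first.
  exact: bounded_integrable fK.
  exact: (@bounded_integrable _ _ _ _ (cst K) `|K|).
rewrite Rintegral_prob_cst RintegralD//; last 2 first.
  exact: bounded_density_integrable fK.
  exact: (@bounded_density_integrable (cst K) `|K|).
rewrite RintegralZl ?integral_density1//; last exact: density_integrable.
by rewrite mulr1 => /addIr.
Qed.

End bounded_density.

Section random_variable_density.
Context (R : realType) d (T : measurableType d) (P : probability T R).

Lemma Rintegral_RV_density (X : {RV P >-> R}) (p : R -> R) :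
  measurable_fun setT p -> (forall x, 0 <= p x) ->
  (forall A, measurable A ->
    P (X @^-1` A) = (\int[lebesgue_measure]_(x in A) (p x)%:E)%E) ->
  forall (f : R -> R) (K : R), measurable_fun setT f ->
  (forall x, `|f x| <= K) ->
  \int[P]_w f (X w) = \int[lebesgue_measure]_x (f x * p x).
Proof.
move=> mp p0 XE f K mf fK.
pose Y : T -> measurableTypeR R := X.
have mY : measurable_fun setT Y by exact: (measurable_funPT X).
pose Y' : {mfun T >-> measurableTypeR R} :=
  HB.pack Y (isMeasurableFun.Build _ _ _ _ Y mY).
have := @bounded_Rintegral_density R _ (measurableTypeR R)
  lebesgue_measure (distribution P Y') p mp p0 XE f K mf fK.
move=> <-; rewrite /Rintegral; congr fine.
rewrite integral_distribution//=.
  exact/measurable_EFinP.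
apply: (@bounded_integrable _ _ _ P (f \o Y) K) => [|x]; last exact: fK.
  exact: measurableT_comp mf mY.
Qed.

End random_variable_density.

(** * Calculus on the real line *)

Section calculus.
Context (R : realType).
Implicit Types f F : R -> R.

Lemma derivable_continuous f : (forall x : R, derivable f x 1) -> continuous f.
Proof.
by move=> df x; apply: differentiable_continuous; exact/derivable1_diffP.
Qed.

Lemma is_derive_FTC f F (a b : R) : a < b -> (forall x : R, is_derive x 1 F (f x)) ->
  continuous f ->
  \int[lebesgue_measure]_(x in `[a, b]) f x = F b - F a.
Proof.
move=> ab dF cf.
have cF : continuous F by apply: derivable_continuous => x; exact: ex_derive.
rewrite /Rintegral (@continuous_FTC2 _ f F) ?fineB//.
- exact: continuous_subspaceT.
- split=> [x _| |]; first exact: ex_derive.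
    by apply: cvg_at_right_filter; exact: cF.
  by apply: cvg_at_left_filter; exact: cF.
- by move=> x _; rewrite derive1E derive_val.
Qed.

Lemma is_derive_ge0_FTCy f F (a l : R) : (forall x, a <= x -> 0 <= f x) ->
  (forall x : R, is_derive x 1 F (f x)) -> continuous f ->
  F x @[x --> +oo] --> l ->
  \int[lebesgue_measure]_(x in `[a, +oo[) f x = l - F a.
Proof.
move=> f0 dF cf Fl.
have cF : continuous F by apply: derivable_continuous => x; exact: ex_derive.
apply: Rintegral_ge0_continuous_FTC2y => //.
- exact: continuous_subspaceT.
- by apply: cvg_at_right_filter; exact: cF.
- by move=> x _; rewrite derive1E derive_val.
Qed.

Lemma cvgr_expRM (e : R) : 0 < e -> expR (- e * x) @[x --> +oo] --> 0.
Proof.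
move=> e0.
rewrite (_ : (fun x => expR (- e * x)) =
             (fun z => expR (- z)) \o (fun z => e * z)); last first.
  by apply/funext => x /=; rewrite mulNr.
apply: (@cvg_comp _ _ _ _ _ _ (pinfty_nbhs R)); last exact: cvgr_expR.
exact: gt0_cvgMry.
Qed.

End calculus.

Section more_calculus.
Context (R : realType).
Implicit Types f F : R -> R.

Lemma is_derive_FTC_le f F (a b : R) : a <= b ->
  (forall x : R, is_derive x 1 F (f x)) -> continuous f ->
  \int[lebesgue_measure]_(x in `[a, b]) f x = F b - F a.
Proof.
rewrite le_eqVlt => /orP[/eqP <- _ _|]; last exact: is_derive_FTC.
by rewrite set_itv1 Rintegral_set1 subrr.
Qed.

Lemma is_derive_nondecreasing f F (a b : R) : a <= b ->
  (forall x : R, is_derive x 1 F (f x)) -> (forall x, a <= x -> 0 <= f x) ->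
  F a <= F b.
Proof.
rewrite le_eqVlt => /orP[/eqP <- //|ab] dF f0.
have cF : {within `[a, b], continuous F}.
  apply: continuous_subspaceT; apply: derivable_continuous => x.
  exact: ex_derive.
have [x xab FE] := @MVT _ F f a b ab (fun x _ => dF x) cF.
move: xab; rewrite in_itv/= => /andP[ax _].
by rewrite -subr_ge0 FE mulr_ge0 ?subr_ge0 ?f0// ltW.
Qed.

End more_calculus.

Section taylor_bounds.
Context (R : realType).
Implicit Type x : R.

Lemma sin_le_id x : 0 <= x -> sin x <= x.
Proof.
move=> x0; have dF (y : R) : is_derive y 1 (fun y => y - sin y) (1 - cos y).
  by apply: is_derive_eq.
have := is_derive_nondecreasing x0 dF.
rewrite sin0 subrr subr_ge0; apply => y _.
by rewrite subr_ge0 cos_le1.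
Qed.

Lemma cos_ge2 x : 0 <= x -> 1 - x ^+ 2 / 2 <= cos x.
Proof.
move=> x0; pose F (y : R) := cos y + y ^+ 2 / 2.
have dF (y : R) : is_derive y 1 F (y - sin y).
  by apply: is_derive_eq; rewrite /GRing.scale/=; field.
have h : F 0 <= F x.
  by apply: (is_derive_nondecreasing x0 dF) => y y0; have := sin_le_id y0; lra.
by move: h; rewrite /F cos0 expr0n/=; lra.
Qed.

Lemma sin_ge3 x : 0 <= x -> x - x ^+ 3 / 6 <= sin x.
Proof.
move=> x0; pose F (y : R) := sin y - y + y ^+ 3 / 6.
have dF (y : R) : is_derive y 1 F (cos y - 1 + y ^+ 2 / 2).
  by apply: is_derive_eq; rewrite /GRing.scale/=; field.
have h : F 0 <= F x.
  by apply: (is_derive_nondecreasing x0 dF) => y y0; have := cos_ge2 y0; lra.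
by move: h; rewrite /F sin0 expr0n/=; lra.
Qed.

Lemma cos_le4 x : 0 <= x -> cos x <= 1 - x ^+ 2 / 2 + x ^+ 4 / 24.
Proof.
move=> x0; pose F (y : R) := 1 - y ^+ 2 / 2 + y ^+ 4 / 24 - cos y.
have dF (y : R) : is_derive y 1 F (sin y - y + y ^+ 3 / 6).
  by apply: is_derive_eq; rewrite /GRing.scale/=; field.
have h : F 0 <= F x.
  by apply: (is_derive_nondecreasing x0 dF) => y y0; have := sin_ge3 y0; lra.
by move: h; rewrite /F cos0 !expr0n/=; lra.
Qed.

Lemma sin_le5 x : 0 <= x -> sin x <= x - x ^+ 3 / 6 + x ^+ 5 / 120.
Proof.
move=> x0; pose F (y : R) := y - y ^+ 3 / 6 + y ^+ 5 / 120 - sin y.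
have dF (y : R) : is_derive y 1 F (1 - y ^+ 2 / 2 + y ^+ 4 / 24 - cos y).
  by apply: is_derive_eq; rewrite /GRing.scale/=; field.
have h : F 0 <= F x.
  by apply: (is_derive_nondecreasing x0 dF) => y y0; have := cos_le4 y0; lra.
by move: h; rewrite /F sin0 !expr0n/=; lra.
Qed.

End taylor_bounds.

(** * From cosine transforms to distribution functions *)

Section cauchy_kernel.
Context (R : realType) (e : R) (e0 : 0 < e).

(** The integrand changes sign, whereas the improper fundamental theorem wants a
    nonnegative function; hence the detour through 1 + cos. *)
Lemma exponential_cos_transform (y : R) :
  \int[lebesgue_measure]_s (cos (s * y) * exponential_pdf e s) =
  e ^+ 2 / (e ^+ 2 + y ^+ 2).
Proof.
have D0 : 0 < e ^+ 2 + y ^+ 2 by rewrite ltr_pwDl ?exprn_gt0 ?sqr_ge0.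
have mpdf := measurable_exponential_pdf e.
have pdf0 x : 0 <= exponential_pdf e x by exact: exponential_pdf_ge0 (ltW e0) x.
have Ipdf := integrable_exponential_pdf e0.
have Icos : lebesgue_measure.-integrable setT
    (EFin \o (fun s => cos (s * y) * exponential_pdf e s)).
  rewrite [X in integrable _ _ X](_ : _ = (EFin \o (fun s => cos (s * y)))
     \* (EFin \o exponential_pdf e))%E//.
  apply: integrableMr => //.
    apply: continuous_measurable_fun; apply: derivable_continuous => x.
    exact: ex_derive.
  exists 1; split; first exact: num_real.
  move=> M M1 x _; apply: le_trans (ltW M1); by rewrite /= ler_norml cos_geN1 cos_le1.
suff : \int[lebesgue_measure]_s ((1 + cos (s * y)) * exponential_pdf e s) =
    1 + e ^+ 2 / (e ^+ 2 + y ^+ 2).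
  under eq_Rintegral do rewrite mulrDl mul1r.
  rewrite RintegralD//.
  rewrite {1}/Rintegral integral_exponential_pdf//=.
  by move/addrI.
pose g s := (1 + cos (s * y)) * (e * expR (- e * s)).
rewrite [LHS](_ : _ = \int[lebesgue_measure]_(s in `[0, +oo[) g s); last first.
  rewrite [RHS]Rintegral_mkcond; apply: eq_Rintegral => s _.
  by rewrite /g /exponential_pdf !patchE; case: ifP; rewrite ?mulr0.
pose F s := - expR (- e * s) + expR (- e * s) *
  ((e / (e ^+ 2 + y ^+ 2)) * (y * sin (s * y) - e * cos (s * y))).
have g0 x : 0 <= x -> 0 <= g x.
  move=> _; apply: mulr_ge0; last by rewrite mulr_ge0 ?expR_ge0 ?(ltW e0).
  by have := cos_geN1 (x * y); lra.
have dF (x : R) : is_derive x 1 F (g x).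
  rewrite /F /g; apply: is_derive_eq.
  by rewrite /GRing.scale/=; field; exact: lt0r_neq0.
have cg : continuous g by apply: derivable_continuous => x; exact: ex_derive.
have Fl : F x @[x --> +oo] --> 0.
  pose C := 1 + (e / (e ^+ 2 + y ^+ 2)) * (`|y| + e).
  apply: norm_cvg0.
  apply: (@squeeze_cvgr _ _ _ _ (cst 0) (fun x => expR (- e * x) * C)).
  - near=> x; rewrite normr_ge0/= /F -mulrN1 -mulrDr normrM.
    rewrite ger0_norm ?expR_ge0// ler_wpM2l ?expR_ge0// /C.
    rewrite (le_trans (ler_normD _ _))// normrN1 lerD2l normrM.
    rewrite ger0_norm ?divr_ge0 ?(ltW e0) ?(ltW D0)//.
    rewrite ler_wpM2l ?divr_ge0 ?(ltW e0) ?(ltW D0)//.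
    rewrite (le_trans (ler_normB _ _))// lerD//.
      by rewrite normrM ler_piMr// ler_norml sin_geN1 sin_le1.
    by rewrite normrM (gtr0_norm e0) ler_piMr ?(ltW e0)// ler_norml cos_geN1 cos_le1.
  - exact: cvg_cst.
  - by rewrite -[X in _ --> X](mul0r C); apply: cvgMr_tmp; exact: cvgr_expRM.
rewrite (is_derive_ge0_FTCy g0 dF cg Fl) /F mulr0 mul0r expR0 sin0 cos0.
by field; exact: lt0r_neq0.
Unshelve. all: end_near. Qed.

Lemma cauchy_kernel_atan (y c d : R) : c < d ->
  \int[lebesgue_measure]_(a in `[c, d]) (e ^+ 2 / (e ^+ 2 + (y - a) ^+ 2)) =
  e * (atan ((y - c) / e) - atan ((y - d) / e)).
Proof.
move=> cd.
have D0 a : e ^+ 2 + (y - a) ^+ 2 != 0.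
  by apply: lt0r_neq0; rewrite ltr_pwDl ?exprn_gt0 ?sqr_ge0.
pose F a := - e * atan ((y - a) / e).
have dF (x : R) : is_derive x 1 F (e ^+ 2 / (e ^+ 2 + (y - x) ^+ 2)).
  rewrite /F; apply: is_derive_eq; rewrite /GRing.scale/=.
  have -> : 1 + ((y - x) / e) ^+ 2 = (e ^+ 2 + (y - x) ^+ 2) / e ^+ 2.
    by field; exact: lt0r_neq0.
  by field; rewrite D0 lt0r_neq0.
rewrite (is_derive_FTC cd dF); first by rewrite /F; ring.
move=> x; apply: cvgM; first exact: cvg_cst.
apply: cvgV; first exact: D0.
apply: (@derivable_continuous _ (fun a => e ^+ 2 + (y - a) ^+ 2)) => z.
exact: ex_derive.
Qed.

End cauchy_kernel.

Section probability_of_events.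
Context (R : realType) d (T : measurableType d) (P : probability T R).
Implicit Types (A B : set T).

Definition pr A : R := fine (P A).

Lemma prE A : measurable A -> P A = (pr A)%:E.
Proof. by move=> mA; rewrite fineK// fin_num_measure. Qed.

Lemma pr_ge0 A : 0 <= pr A.
Proof. exact: fine_ge0. Qed.

Lemma measurable_RV_preimage (Z : {RV P >-> R}) (Q : set R) :
  measurable Q -> measurable (Z @^-1` Q).
Proof.
by move=> mQ; rewrite -[X in measurable X]setTI; exact: measurable_funPT.
Qed.

Lemma measurable_RV_le (Z : {RV P >-> R}) x : measurable [set w | Z w <= x].
Proof.
rewrite (_ : mkset _ = Z @^-1` `]-oo, x]); first exact: measurable_RV_preimage.
by apply/seteqP; split => w /=; rewrite in_itv.
Qed.

Lemma measurable_RV_gt (Z : {RV P >-> R}) x : measurable [set w | x < Z w].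
Proof.
rewrite (_ : mkset _ = Z @^-1` `]x, +oo[); first exact: measurable_RV_preimage.
by apply/seteqP; split => w /=; rewrite in_itv/= andbT.
Qed.

Lemma cdf_pr (Z : {RV P >-> R}) x : cdf Z x = (pr [set w | Z w <= x])%:E.
Proof.
rewrite -prE; last exact: measurable_RV_le.
have -> : [set w | Z w <= x] = Z @^-1` `]-oo, x]; last by [].
by apply/seteqP; split => w /=; rewrite in_itv.
Qed.

Lemma pr_le A B : measurable A -> measurable B -> A `<=` B -> pr A <= pr B.
Proof. by move=> mA mB AB; rewrite -lee_fin -!prE// le_measure ?inE. Qed.

Lemma pr_leU A B C : measurable A -> measurable B -> measurable C ->
  A `<=` B `|` C -> pr A <= pr B + pr C.
Proof.
move=> mA mB mC ABC; rewrite -lee_fin EFinD -!prE//.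
apply: le_trans (measureU2 _ mB mC); rewrite le_measure ?inE//.
exact: measurableU.
Qed.

Lemma prT : pr setT = 1.
Proof. by rewrite /pr; have := probability_setT P; move=> /= ->. Qed.

Lemma prC A : measurable A -> pr (~` A) = 1 - pr A.
Proof.
move=> mA; rewrite /pr; have := probability_setC P mA; move=> /= ->.
by rewrite prE.
Qed.

Lemma Rintegral_indic_pr A : measurable A -> \int[P]_w \1_A w = pr A.
Proof. by move=> mA; rewrite /Rintegral integral_indic// setIT. Qed.

End probability_of_events.


Lemma normr_cos_le1 (R : realType) (x : R) : `|cos x| <= 1.
Proof. by rewrite ler_norml cos_geN1 cos_le1. Qed.

Lemma measurable_cosM (R : realType) d (T : measurableType d) (f : T -> R) :
  measurable_fun setT f -> measurable_fun setT (fun x => cos (f x)).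
Proof.
move=> mf; apply: measurableT_comp mf.
by apply: continuous_measurable_fun; exact: continuous_cos.
Qed.

Section levy_continuity.
Context (R : realType) d d' (T : measurableType d) (T' : measurableType d').
Variables (P : probability T R) (P' : probability T' R).
Variables (Y_ : nat -> {RV P >-> R}) (Y : {RV P' >-> R}).
Hypothesis cos_cvg : forall s a : R, 0 < s ->
  \int[P]_w cos (s * (Y_ n w - a)) @[n --> \oo] -->
  \int[P']_w cos (s * (Y w - a)).

Let cos_cvgT (s a : R) :
  \int[P]_w cos (s * (Y_ n w - a)) @[n --> \oo] -->
  \int[P']_w cos (s * (Y w - a)).
Proof.
have [s0|s0|<-] := ltgtP 0 s; first exact: cos_cvg.
- have := @cos_cvg (- s) a; rewrite oppr_gt0 => /(_ s0).
  under eq_fun do under eq_Rintegral do rewrite mulNr cosN.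
  by under [X in _ --> X -> _]eq_Rintegral do rewrite mulNr cosN.
- have E d1 (T1 : measurableType d1) (P1 : probability T1 R) (Z : T1 -> R) :
      \int[P1]_w cos (0 * (Z w - a)) = 1.
    rewrite -[RHS](Rintegral_prob_cst P1); apply: eq_Rintegral => w _.
    by rewrite mul0r cos0.
  by rewrite E; under eq_fun do rewrite E; exact: cvg_cst.
Qed.

(** The Cauchy kernel is the mean of cos (s (Y - a)) when s has an exponential
    law, so by Fubini its expectation is a mixture of cosine transforms, and
    dominated convergence passes to the limit. *)
Lemma cauchy_expectation_cvg (e a : R) : 0 < e ->
  \int[P]_w (e ^+ 2 / (e ^+ 2 + (Y_ n w - a) ^+ 2)) @[n --> \oo] -->
  \int[P']_w (e ^+ 2 / (e ^+ 2 + (Y w - a) ^+ 2)).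
Proof.
move=> e0.
unshelve epose (Q := (exponential_prob e : probability (measurableTypeR R) R)).
  exact: e0.
have fubini d1 (T1 : measurableType d1) (P1 : probability T1 R)
    (Z : {RV P1 >-> R}) :
    measurable_fun setT
      (fun s : measurableTypeR R => \int[P1]_w cos ((s : R) * (Z w - a))) /\
    \int[P1]_w (e ^+ 2 / (e ^+ 2 + (Z w - a) ^+ 2)) =
    \int[Q]_s \int[P1]_w cos ((s : R) * (Z w - a)).
  pose f (x : measurableTypeR R * T1) : R := cos ((x.1 : R) * (Z x.2 - a)).
  have mf : measurable_fun setT f.
    apply: measurable_cosM; apply: measurable_funM => //.
    by apply: measurable_funB => //; exact: measurableT_comp.
  have f1 x : `|f x| <= 1 by exact: normr_cos_le1.
  split; first exact: (measurable_Rintegral_section Q P1 mf f1).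
  rewrite (bounded_Fubini Q P1 mf f1); apply: eq_Rintegral => w _.
  rewrite -exponential_cos_transform//.
  rewrite (@bounded_Rintegral_density R _ (measurableTypeR R) lebesgue_measure Q
    (exponential_pdf e) (measurable_exponential_pdf e)
    (exponential_pdf_ge0 (ltW e0)) _ (fun s => cos (s * (Z w - a))) 1)//.
    exact: measurableT_comp mf (pair2_measurable w).
  by move=> s; exact: normr_cos_le1.
have [mY ->] := fubini _ _ _ Y.
under eq_fun do rewrite (fubini _ _ _ (Y_ _)).2.
apply: (@bounded_cvg_Rintegral _ _ _ Q _ _ 1) => // [n|n s].
  exact: (fubini _ _ _ (Y_ n)).1.
apply: bounded_norm_Rintegral => [|w]; last exact: normr_cos_le1.
apply: measurable_cosM; apply: measurable_funM => //.
exact: measurable_funB.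
Qed.

(** Averaging the Cauchy kernel over its centre, uniform on [a, b], gives a
    smoothed indicator of [a, b]. *)
Lemma atan_expectation_cvg (e a b : R) : 0 < e -> a < b ->
  \int[P]_w (atan ((Y_ n w - a) / e) - atan ((Y_ n w - b) / e)) @[n --> \oo]
  --> \int[P']_w (atan ((Y w - a) / e) - atan ((Y w - b) / e)).
Proof.
move=> e0 ab.
pose Q := (uniform_prob ab : probability (measurableTypeR R) R).
pose k (y c : R) := e ^+ 2 / (e ^+ 2 + (y - c) ^+ 2).
have D0 y : 0 < e ^+ 2 + y ^+ 2 by rewrite ltr_pwDl ?exprn_gt0 ?sqr_ge0.
have k0 y c : 0 <= k y c by rewrite divr_ge0 ?sqr_ge0// ltW.
have k1 y c : `|k y c| <= 1.
  by rewrite ger0_norm// ler_pdivrMr// mul1r lerDl sqr_ge0.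
have ck : continuous (fun y : R => e ^+ 2 / (e ^+ 2 + y ^+ 2)).
  move=> y; apply: cvgM; first exact: cvg_cst.
  apply: cvgV; first by rewrite lt0r_neq0.
  apply: (@derivable_continuous _ (fun y => e ^+ 2 + y ^+ 2)) => z.
  exact: ex_derive.
have uniform_k y : \int[Q]_c k y (c : R) =
    (b - a)^-1 * (e * (atan ((y - a) / e) - atan ((y - b) / e))).
  rewrite -cauchy_kernel_atan// /Rintegral integral_uniform; last 2 first.
    apply/measurable_EFinP.
    apply: (measurableT_comp (continuous_measurable_fun ck)).
    exact: measurable_funB.
    by move=> c; rewrite lee_fin.
  rewrite fineM//.
  apply: integrable_fin_num => //.
  apply: continuous_compact_integrable; first exact: segment_compact.
  apply: continuous_subspaceT => x.
  apply: (@continuous_comp _ _ _ (fun c => y - c)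
    (fun y : R => e ^+ 2 / (e ^+ 2 + y ^+ 2))); last exact: ck.
  by apply: (@derivable_continuous _ (fun c => y - c)) => z; exact: ex_derive.
have C0 : (b - a)^-1 * e != 0.
  by rewrite mulf_neq0 ?invr_eq0 ?subr_eq0 ?gt_eqF.
have fubini d1 (T1 : measurableType d1) (P1 : probability T1 R)
    (Z : {RV P1 >-> R}) :
    measurable_fun setT (fun c : measurableTypeR R => \int[P1]_w k (Z w) (c : R)) /\
    \int[P1]_w (atan ((Z w - a) / e) - atan ((Z w - b) / e)) =
    ((b - a)^-1 * e)^-1 * \int[Q]_c \int[P1]_w k (Z w) (c : R).
  pose f (x : measurableTypeR R * T1) : R := k (Z x.2) (x.1 : R).
  have mf : measurable_fun setT f.
    apply: (measurableT_comp (continuous_measurable_fun ck)).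
    by apply: measurable_funB => //; exact: measurableT_comp.
  have f1 x : `|f x| <= 1 by exact: k1.
  split; first exact: (measurable_Rintegral_section Q P1 mf f1).
  rewrite (bounded_Fubini Q P1 mf f1) -RintegralZl//; last first.
    apply: (@bounded_integrable _ _ _ P1 _ 1) => [|w].
      pose g (x : T1 * measurableTypeR R) : R := k (Z x.1) (x.2 : R).
      have mg : measurable_fun setT g.
        apply: (measurableT_comp (continuous_measurable_fun ck)).
        by apply: measurable_funB => //; exact: measurableT_comp.
      exact: (measurable_Rintegral_section P1 Q mg (fun x => k1 _ _)).
    apply: bounded_norm_Rintegral => [|c //].
    exact: measurableT_comp mf (pair2_measurable w).
  apply: eq_Rintegral => w _.
    transitivity (((b - a)^-1 * e)^-1 * \int[Q]_c k (Z w) (c : R)) => //.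
  by rewrite uniform_k [(b - a)^-1 * (e * _)]mulrA mulKf.
have [mY ->] := fubini _ _ _ Y.
under eq_fun do rewrite (fubini _ _ _ (Y_ _)).2.
apply: cvgMl_tmp.
apply: (@bounded_cvg_Rintegral _ _ _ Q _ _ 1) => [n|n c|c].
- exact: (fubini _ _ _ (Y_ n)).1.
- apply: bounded_norm_Rintegral => [|w //].
  apply: (measurableT_comp (continuous_measurable_fun ck)).
  exact: measurable_funB.
- exact: cauchy_expectation_cvg.
Qed.


(** For e small, the difference K of arctangents is nearly pi on the smaller
    interval and nearly 0 outside the larger one: comparing K with the two
    indicators turns convergence of E K into a lower bound on interval
    probabilities.  Lower bounds on bounded intervals also exclude an escape of
    mass to infinity. *)
Lemma interval_probability_liminf (a b del eps : R) :
  0 < del -> 0 < eps -> a + del <= b - del ->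
  \forall n \near \oo, pr P' [set w | a + del <= Y w <= b - del] - eps <=
    pr P [set w | a < Y_ n w < b].
Proof.
move=> del0 eps0 ab.
have [x0 x0_gt0 atan_x0] : exists2 x0, 0 < x0 & pi / 2 - eps / 2 < atan x0.
  have : \forall x \near +oo, pi / 2 - eps / 2 < @atan R x.
    apply: (cvgr_gt _ (@cvgy_atan R)); lra.
  move=> near_x0; near (pinfty_nbhs R) => x0; exists x0.
    by near: x0; exact: nbhs_pinfty_gt.
  by near: x0.
(* c and d0 are half-way between the endpoints of the two intervals. *)
pose e := del / 2 / x0; pose c := a + del / 2; pose d0 := b - del / 2.
have e0 : 0 < e by rewrite !divr_gt0.
have cd : c < d0 by rewrite /c /d0; lra.
have atan_lb z : x0 * e <= z -> pi / 2 - eps / 2 <= atan (z / e).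
  move=> h; rewrite (le_trans (ltW atan_x0))// le_atan//.
  by rewrite ler_pdivlMr.
have atan_ub z : z <= - (x0 * e) -> atan (z / e) <= - (pi / 2 - eps / 2).
  move=> h; rewrite -[z]opprK mulNr atanN lerN2 atan_lb//; lra.
have x0e : x0 * e = del / 2 by rewrite /e mulrC divfK// gt_eqF.
have pi2 : 2 <= pi :> R by exact: pi_ge2.
pose K y := atan ((y - c) / e) - atan ((y - d0) / e).
have K0 y : 0 <= K y.
  rewrite subr_ge0 le_atan// ler_pM2r ?invr_gt0//; lra.
have Kpi y : K y <= pi.
  by have := @atan_ltpi2 R ((y - c) / e); have := @atan_gtNpi2 R ((y - d0) / e); rewrite /K; lra.
have mK : measurable_fun setT K.
  apply: continuous_measurable_fun; apply: derivable_continuous => z.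
  exact: ex_derive.
have mKY d1 (T1 : measurableType d1) (P1 : probability T1 R)
    (Z : {RV P1 >-> R}) : P1.-integrable setT (EFin \o (fun w => K (Z w))).
  apply: (@bounded_integrable _ _ _ P1 _ pi) => [|w]; last by rewrite ger0_norm.
  exact: measurableT_comp.
have Iind d1 (T1 : measurableType d1) (P1 : probability T1 R) (A : set T1) (k : R) :
    measurable A -> P1.-integrable setT (EFin \o (fun w => k * \1_A w)).
  move=> mA; apply: (@bounded_integrable _ _ _ P1 _ `|k|) => [|w].
    by apply: measurable_funM => //; exact: measurable_indic.
  by rewrite normrM ler_piMr// indicE ger0_norm// lern1; case: (_ \in _).
have Icst d1 (T1 : measurableType d1) (P1 : probability T1 R) (k : R) :
    P1.-integrable setT (EFin \o (fun=> k) : T1 -> \bar R).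
  exact: (@bounded_integrable _ _ _ P1 _ `|k|).
have mI1 d1 (T1 : measurableType d1) (P1 : probability T1 R) (A : set T1) :
    measurable A -> P1.-integrable setT (EFin \o \1_A).
  move=> mA; have := Iind _ _ P1 A 1 mA.
  by congr (integrable _ _ _); apply/funext => w /=; rewrite mul1r.
set A' := [set w | _ <= _ <= _].
have mA' : measurable A'.
  rewrite (_ : A' = Y @^-1` `[a + del, b - del]); first exact: measurable_RV_preimage.
  by apply/seteqP; split => w /=; rewrite in_itv.
have lower : (pi - eps) * pr P' A' <= \int[P']_w K (Y w).
  rewrite -Rintegral_indic_pr// -RintegralZl//; last exact: mI1.
  apply: le_Rintegral => //; [exact: Iind|exact: mKY|move=> w _].
  rewrite indicE; case: (boolP (w \in A')) => [|_]; last by rewrite mulr0.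
  rewrite inE /A' /= => /andP[h1 h2]; rewrite mulr1 /K.
  have h3 : pi / 2 - eps / 2 <= atan ((Y w - c) / e).
    by apply: atan_lb; rewrite x0e /c; lra.
  have h4 : atan ((Y w - d0) / e) <= - (pi / 2 - eps / 2).
    by apply: atan_ub; rewrite x0e /d0; lra.
  lra.
have upper n : \int[P]_w K (Y_ n w) <=
    pi * pr P [set w | a < Y_ n w < b] + eps / 2.
  set A := [set w | _ < _ < _].
  have mA : measurable A.
    rewrite (_ : A = Y_ n @^-1` `]a, b[); first exact: measurable_RV_preimage.
    by apply/seteqP; split => w /=; rewrite in_itv.
  rewrite -[X in _ + X](Rintegral_prob_cst P) -Rintegral_indic_pr//.
  rewrite -RintegralZl//; last exact: mI1.
  rewrite -RintegralD//; [|exact: Iind|exact: Icst].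
  apply: le_Rintegral => //; [exact: mKY| |move=> w _].
    apply: (@bounded_integrable _ _ _ P _ (pi + eps / 2)) => [|w].
      have mindic : measurable_fun setT (\1_A : T -> R) by exact: measurable_indic.
      by apply: measurable_funD => //; exact: measurable_funM.
    rewrite indicE; case: (_ \in _); rewrite ?mulr1 ?mulr0 ger0_norm//; lra.
  have hl := @atan_gtNpi2 R ((Y_ n w - d0) / e).
  have hu := @atan_ltpi2 R ((Y_ n w - c) / e).
  rewrite indicE; case: (boolP (w \in A)) => [_|].
    by have := Kpi (Y_ n w); rewrite mulr1; lra.
  rewrite notin_setE /A/= => /negP; rewrite negb_and -!leNgt => /orP[h|h]; rewrite mulr0 add0r.
    have : atan ((Y_ n w - c) / e) <= - (pi / 2 - eps / 2).
      by apply: atan_ub; rewrite x0e /c; lra.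
    rewrite /K; lra.
  have : pi / 2 - eps / 2 <= atan ((Y_ n w - d0) / e).
    by apply: atan_lb; rewrite x0e /d0; lra.
  rewrite /K; lra.
have := atan_expectation_cvg e0 cd => /cvgrPdist_le/(_ (eps / 2)).
rewrite divr_gt0// => /(_ isT); apply: filterS => n.
rewrite ler_norml => /andP[_ h].
have p0 := pr_ge0 P' A'.
have p1 : pr P' A' <= 1 by rewrite -(prT P'); exact: pr_le.
have := upper n; move: (pr P _) lower h p0 p1 => q.
rewrite -/K; move: (pr P' A') (\int[P']_w _) (\int[P]_w _) => p I J.
move=> h1 h2 p0 p1 h3.
suff : pi * (p - eps - q) <= 0 by rewrite pmulr_rle0 ?pi_gt0//; lra.
nra.
Unshelve. all: end_near. Qed.

(** Lower bounds on the probabilities of an interval ending at x and of one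
    starting at x bound the distribution function at x from both sides. *)
Theorem levy_cdf (x : R) : {for x, continuous (cdf Y)} ->
  pr P [set w | Y_ n w <= x] @[n --> \oo] --> pr P' [set w | Y w <= x].
Proof.
pose F z := pr P' [set w | Y w <= z].
have cdfE z : cdf Y z = (F z)%:E by exact: cdf_pr.
have FE : F = fine \o cdf Y by apply/funext => z; rewrite /= cdfE.
move=> cF.
have {}cF : F z @[z --> x] --> F x.
  by rewrite FE; apply: fine_cvg; rewrite /= cdfE/= -cdfE; exact: cF.
have F0 : F z @[z --> -oo] --> (0 : R).
  by rewrite FE; apply: fine_cvg; exact: cvg_cdfNy0.
have F1 : F z @[z --> +oo] --> (1 : R).
  by rewrite FE; apply: fine_cvg; exact: cvg_cdfy1.
apply/cvgrPdist_le => /= e e0.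
have e4 : 0 < e / 4 by rewrite divr_gt0.
have [del del0 Fdel] : exists2 del, 0 < del &
    forall z, `|x - z| <= del -> `|F x - F z| <= e / 4.
  have /cvgrPdist_le/(_ _ e4) := cF.
  move=> /nbhs_ballP[r /= r0 h]; exists (r / 2); first by rewrite divr_gt0.
  move=> z hz; apply: h; rewrite /ball/=; apply: le_lt_trans hz _; lra.
have [a ax Fa] : exists2 a, a < x - del & F a <= e / 4.
  have near_a : \forall a \near -oo, F a <= e / 4 by exact: (cvgr_le _ F0).
  near (ninfty_nbhs R) => a; exists a; last by near: a.
  by near: a; apply: nbhs_ninfty_lt; exact: num_real.
have [b xb Fb] : exists2 b, x + del < b & 1 - e / 4 <= F b.
  have near_b : \forall b \near +oo, 1 - e / 4 <= F b.
    by apply: (cvgr_ge _ F1); lra.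
  near (pinfty_nbhs R) => b; exists b; first by near: b; apply: nbhs_pinfty_gt; exact: num_real.
  by near: b.
have h1 : F (x - del) <= F a + pr P' [set w | a - del + del <= Y w <= x - del].
  apply: pr_leU; [exact: measurable_RV_le|exact: measurable_RV_le| |].
    rewrite (_ : mkset _ = Y @^-1` `[a - del + del, x - del]); first exact: measurable_RV_preimage.
    by apply/seteqP; split => w /=; rewrite in_itv.
  move=> w /= wx; have [|/ltW wa] := leP (Y w) a; first by left.
  by right; rewrite subrK wa wx.
have h2 : F b <= F (x + del) +
    pr P' [set w | x + del <= Y w <= b + del - del].
  apply: pr_leU; [exact: measurable_RV_le|exact: measurable_RV_le| |].
    rewrite (_ : mkset _ = Y @^-1` `[x + del, b + del - del]); first exact: measurable_RV_preimage.
    by apply/seteqP; split => w /=; rewrite in_itv.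
  move=> w /= wb; have [|/ltW wa] := leP (Y w) (x + del); first by left.
  by right; rewrite addrK wa wb.
have := @interval_probability_liminf (a - del) x del _ del0 e4.
have -> : a - del + del <= x - del by lra.
move=> /(_ isT) l1.
have := @interval_probability_liminf x (b + del) del _ del0 e4.
have -> : x + del <= b + del - del by lra.
move=> /(_ isT) l2.
near=> n.
have k1 : pr P' [set w | a - del + del <= Y w <= x - del] - e / 4 <=
    pr P [set w | a - del < Y_ n w < x] by near: n.
have k2 : pr P' [set w | x + del <= Y w <= b + del - del] - e / 4 <=
    pr P [set w | x < Y_ n w < b + del] by near: n.
have mo (u v : R) : measurable [set w | u < Y_ n w < v].
  rewrite (_ : mkset _ = Y_ n @^-1` `]u, v[); first exact: measurable_RV_preimage.
  by apply/seteqP; split => w /=; rewrite in_itv.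
have mn : measurable [set w | Y_ n w <= x] by exact: measurable_RV_le.
have u1 : pr P [set w | a - del < Y_ n w < x] <= pr P [set w | Y_ n w <= x].
  by apply: pr_le => // w /= /andP[_ /ltW].
have u2 : pr P [set w | x < Y_ n w < b + del] <= 1 - pr P [set w | Y_ n w <= x].
  rewrite -prC//; apply: pr_le => //; first exact: measurableC.
  by move=> w /= /andP[+ _]; rewrite ltNge => /negP.
have := Fdel (x - del); rewrite subKr gtr0_norm// lexx => /(_ isT).
have := Fdel (x + del); rewrite opprD addNKr normrN gtr0_norm// lexx => /(_ isT).
rewrite -/(F x) !ler_norml => /andP[? ?] /andP[? ?].
by apply/andP; split; lra.
Unshelve. all: end_near. Qed.

End levy_continuity.

(** * Cosine transform of the normal law *)

Lemma integral_derivative_eq0 (R : realType) (f F : R -> R) :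
  (forall x : R, is_derive x 1 F (f x)) -> continuous f ->
  lebesgue_measure.-integrable setT (EFin \o f) ->
  F n%:R @[n --> \oo] --> 0 -> F (- n%:R) @[n --> \oo] --> 0 ->
  \int[lebesgue_measure]_x f x = 0.
Proof.
move=> dF cf intf Fy FNy.
pose D (n : nat) : set R := `[- n%:R, n%:R]%classic.
have mf : measurable_fun setT f by exact: continuous_measurable_fun.
have h1 : \int[lebesgue_measure]_(x in D n) f x @[n --> \oo] -->
    \int[lebesgue_measure]_x f x.
  under eq_fun do rewrite Rintegral_mkcond.
  apply: fine_cvg; rewrite /Rintegral fineK; last exact: integrable_fin_num.
  apply: (@dominated_cvg _ _ _ lebesgue_measure _ measurableT _ _
            (abse \o (EFin \o f))) => //.
  - move=> n; apply/measurable_EFinP.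
    apply: (measurable_restrictT _ _).1; last exact: measurable_funTS.
    exact: measurable_itv.
  - move=> x _; apply: cvg_EFin; first exact: nearW.
    apply: cvg_near_cst; near=> n.
    rewrite /= patchE ifT// inE /D/= in_itv/= -ler_norml.
    by near: n; exact: nbhs_infty_ger.
  - exact: integrable_abse.
  - move=> n x _ /=; rewrite lee_fin patchE; case: ifP => //.
    by rewrite normr0.
have h2 : \int[lebesgue_measure]_(x in D n) f x @[n --> \oo] --> (0 - 0 : R).
  apply: (@cvg_trans _ ((F n%:R - F (- n%:R)) @[n --> \oo])); last exact: cvgB.
  apply: near_eq_cvg; near=> n; apply/esym/is_derive_FTC => //.
  have : (0 < n)%N by near: n; exact: nbhs_infty_gt.
  rewrite -(ltr_nat R); lra.
by have -> := cvg_unique (@Rhausdorff R) h1 h2; rewrite subr0.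
Unshelve. all: end_near. Qed.

Section normal_cosine_transform.
Context (R : realType) (sigma : R) (sigma0 : sigma != 0).
Local Notation g := (normal_pdf 0 sigma).
Local Notation mu := (@lebesgue_measure R).

Let gE x : g x = normal_peak sigma * expR (- x ^+ 2 / (sigma ^+ 2 *+ 2)).
Proof. by rewrite normal_pdfE// /normal_fun subr0. Qed.

Let s20 : 0 < sigma ^+ 2.
Proof. by rewrite exprn_even_gt0. Qed.

Let mg : measurable_fun setT g.
Proof. exact: measurable_normal_pdf. Qed.

Let intg : mu.-integrable setT (EFin \o g).
Proof. exact: integrable_normal_pdf. Qed.

Let g0 x : 0 <= g x. Proof. exact: normal_pdf_ge0. Qed.

Let is_derive_g (x : R) : is_derive x 1 g (- (x / sigma ^+ 2) * g x).
Proof.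
rewrite (_ : g = fun x => normal_peak sigma * expR (- x ^+ 2 / (sigma ^+ 2 *+ 2)));
  last by apply/funext => y; exact: gE.
by apply: is_derive_eq; rewrite /GRing.scale/=; field.
Qed.

Let cg : continuous g.
Proof. by apply: derivable_continuous => x; exact: ex_derive. Qed.

Let cvg_g : g n%:R @[n --> \oo] --> 0.
Proof.
pose c := (sigma ^+ 2 *+ 2)^-1.
have c0 : 0 < c by rewrite invr_gt0 pmulrn_lgt0.
apply: (@squeeze_cvgr _ _ _ _ (cst 0)
  (fun n : nat => normal_peak sigma * expR (- c * n%:R))).
- near=> n; rewrite g0/= gE ler_wpM2l ?normal_peak_ge0// ler_expR.
  rewrite -/c mulNr mulrC mulNr lerN2 ler_wpM2l ?(ltW c0)//.
  rewrite -natrX ler_nat.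
  have : (0 < n)%N by near: n; exact: nbhs_infty_gt.
  by move=> n0; rewrite expnS expn1 leq_pmulr.
- exact: cvg_cst.
- rewrite -[X in _ --> X](mulr0 (normal_peak sigma)); apply: cvgMl_tmp.
  exact: ((cvg_pinftyP _ _).1 (cvgr_expRM c0) _ cvgr_idn).
Unshelve. all: end_near. Qed.

Let gN x : g (- x) = g x. Proof. by rewrite !gE sqrrN. Qed.

(** With u = |x| / |sigma|, the bound u <= 1 + u^2/4 <= exp (u^2/4) turns the
    integrand into a multiple of the density with twice the variance. *)
Let int_norm_g : mu.-integrable setT (EFin \o (fun x => `|x| * g x)).
Proof.
pose s' := Num.sqrt 2 * sigma.
have s'0 : s' != 0 by rewrite mulf_neq0// gt_eqF// sqrtr_gt0.
pose C := `|sigma| * normal_peak sigma / normal_peak s'.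
apply: (@le_integrable _ _ _ mu _ measurableT _
         (EFin \o (fun x => C * normal_pdf 0 s' x))).
- by apply/measurable_EFinP; apply: measurable_funM => //; exact: measurableT_comp.
- move=> x _ /=; rewrite lee_fin [leLHS]ger0_norm ?mulr_ge0//.
  rewrite [leRHS]ger0_norm; last first.
    by rewrite mulr_ge0 ?normal_pdf_ge0// /C divr_ge0 ?mulr_ge0 ?normal_peak_ge0.
  have ns0 : 0 < `|sigma| by rewrite normr_gt0.
  rewrite gE normal_pdfE// /normal_fun subr0 /C.
  have peak0 : normal_peak s' != 0 by rewrite gt_eqF ?normal_peak_gt0.
  rewrite [leRHS](_ : _ = normal_peak sigma *
    (`|sigma| * expR (- x ^+ 2 / (s' ^+ 2 *+ 2)))); last by field.
  rewrite mulrCA ler_wpM2l ?normal_peak_ge0//.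
  have -> : s' ^+ 2 = sigma ^+ 2 *+ 2 by rewrite exprMn sqr_sqrtr// mulr_natl.
  pose u := `|x| / `|sigma|.
  have u2 : u ^+ 2 = x ^+ 2 / sigma ^+ 2.
    by rewrite expr_div_n !real_normK ?num_real.
  have -> : - x ^+ 2 / (sigma ^+ 2 *+ 2) = - (u ^+ 2 / 2).
    by rewrite u2; field.
  have -> : - x ^+ 2 / (sigma ^+ 2 *+ 2 *+ 2) = - (u ^+ 2 / 4).
    by rewrite u2; field.
  have -> : `|x| = `|sigma| * u by rewrite /u mulrC divfK// gt_eqF.
  rewrite -mulrA ler_wpM2l// -ler_pdivlMr ?expR_gt0// -expRN opprK -expRD.
  have -> : - (u ^+ 2 / 4) + u ^+ 2 / 2 = u ^+ 2 / 4 by field.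
  apply: le_trans (expR_ge1Dx _); have := sqr_ge0 (1 - u / 2); lra.
- rewrite [X in integrable _ _ X](_ : _ =
    (fun x => C%:E * (normal_pdf 0 s' x)%:E)%E)//.
  by apply: integrableZl => //; exact: integrable_normal_pdf.
Qed.

Let int_bounded (h : R -> R) : measurable_fun setT h ->
  (forall x, `|h x| <= 1) ->
  mu.-integrable setT (EFin \o (fun x => h x * g x)).
Proof.
move=> mh h1; apply: (@le_integrable _ _ _ mu _ measurableT _ (EFin \o g)) => //.
- by apply/measurable_EFinP; exact: measurable_funM.
- by move=> x _ /=; rewrite lee_fin normrM ler_piMl.
Qed.

Let int_boundedM (h : R -> R) : measurable_fun setT h ->
  (forall x, `|h x| <= 1) ->
  mu.-integrable setT (EFin \o (fun x => x * h x * g x)).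
Proof.
move=> mh h1; apply: (@le_integrable _ _ _ mu _ measurableT _
         (EFin \o (fun x => `|x| * g x))) => //.
- by apply/measurable_EFinP; apply: measurable_funM => //; exact: measurable_funM.
- move=> x _ /=; rewrite lee_fin !normrM (ger0_norm (normr_ge0 _)).
  by rewrite ler_wpM2r// ler_piMr.
Qed.

Let cos1 (s b x : R) : `|cos (s * x + b)| <= 1.
Proof. exact: normr_cos_le1. Qed.

Let sin1 (s b x : R) : `|sin (s * x + b)| <= 1.
Proof. by rewrite ler_norml sin_geN1 sin_le1. Qed.

Let mcos (s b : R) : measurable_fun setT (fun x => cos (s * x + b)).
Proof.
apply: continuous_measurable_fun; apply: derivable_continuous => x.
exact: ex_derive.
Qed.

Let msin (s b : R) : measurable_fun setT (fun x => sin (s * x + b)).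
Proof.
apply: continuous_measurable_fun; apply: derivable_continuous => x.
exact: ex_derive.
Qed.

Let phi (b s : R) := \int[mu]_x (cos (s * x + b) * g x).

Let gauss_by_parts (s b : R) :
  \int[mu]_x (x * sin (s * x + b) * g x) = sigma ^+ 2 * s * phi b s.
Proof.
pose G x := sin (s * x + b) * g x.
pose G' x := s * (cos (s * x + b) * g x) -
  (sigma ^+ 2)^-1 * (x * sin (s * x + b) * g x).
have dG (x : R) : is_derive x 1 G (G' x).
  have dg : is_derive x 1 g _ := is_derive_g x.
  have ds : is_derive x 1 (fun y => sin (s * y + b)) (cos (s * x + b) * s).
    by apply: is_derive_eq; rewrite /GRing.scale/=; ring.
  have := is_deriveM ds dg; rewrite /GRing.scale/= => h.
  by apply: (is_derive_eq h); rewrite /G'; field.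
have i1 := int_bounded (mcos s b) (cos1 s b).
have i2 := int_boundedM (msin s b) (sin1 s b).
have i1' : mu.-integrable setT (EFin \o (fun x => s * (cos (s * x + b) * g x))).
  rewrite [X in integrable _ _ X](_ : _ =
    (fun x => s%:E * (cos (s * x + b) * g x)%:E)%E)//.
  by apply: integrableZl.
have i2' : mu.-integrable setT
    (EFin \o (fun x => (sigma ^+ 2)^-1 * (x * sin (s * x + b) * g x))).
  rewrite [X in integrable _ _ X](_ : _ =
    (fun x => (sigma ^+ 2)^-1%:E * (x * sin (s * x + b) * g x)%:E)%E)//.
  by apply: integrableZl.
have : \int[mu]_x G' x = 0.
  have bound (u : nat -> R) : (forall n, g (u n) = g n%:R) ->
      G (u n) @[n --> \oo] --> 0.
    move=> gu; apply: norm_cvg0.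
    apply: (@squeeze_cvgr _ _ _ _ (cst 0) (fun n : nat => g n%:R)) => //.
    - near=> n; rewrite normr_ge0/= -gu normrM (ger0_norm (g0 _)).
      by rewrite ler_piMl.
    - exact: cvg_cst.
  apply: (integral_derivative_eq0 dG).
  - have cc : continuous (fun x : R => cos (s * x + b)).
      by apply: derivable_continuous => x; exact: ex_derive.
    have cs : continuous (fun x : R => x * sin (s * x + b)).
      by apply: derivable_continuous => x; exact: ex_derive.
    move=> x; apply: cvgB; apply: cvgM; try exact: cvg_cst.
      by apply: cvgM; [exact: cc|exact: cg].
    by apply: cvgM; [exact: cs|exact: cg].
  - rewrite [X in integrable _ _ X](_ : _ =
      (EFin \o (fun x : R => s * (cos (s * x + b) * g x))%R) \-
      (EFin \o (fun x : R => (sigma ^+ 2)^-1 * (x * sin (s * x + b) * g x))%R))%E//.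
    exact: integrableB.
  - exact: (bound (fun n => n%:R)).
  - by apply: (bound (fun n => - n%:R)) => n; rewrite gN.
rewrite /G' RintegralB// !RintegralZl// => /eqP; rewrite subr_eq0 => /eqP h.
by rewrite /phi -mulrA h mulrA mulfV ?mul1r// gt_eqF.
Unshelve. all: end_near. Qed.

Let is_derive_phi (b s : R) : is_derive s 1 (phi b) (- (sigma ^+ 2 * s * phi b s)).
Proof.
pose f (s x : R) := cos (s * x + b) * g x.
have pf (t x : R) : partial1of2 f t x = - (x * sin (t * x + b) * g x).
  rewrite /partial1of2 /f derive1E.
  have : is_derive t 1 (fun t => cos (t * x + b) * g x)
      (- (x * sin (t * x + b) * g x)).
    by apply: is_derive_eq; rewrite /GRing.scale/=; ring.
  by move=> ?; rewrite derive_val.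
have Is : `]s - 1, s + 1[%classic s by rewrite /= in_itv/=; apply/andP; split; lra.
have intf t : `]s - 1, s + 1[%classic t -> mu.-integrable setT (EFin \o f t).
  by move=> _; exact: int_bounded.
have derf t x : `]s - 1, s + 1[%classic t -> setT x -> derivable (f ^~ x) t 1.
  by move=> _ _; exact: ex_derive.
have G0 x : 0 <= `|x| * g x by rewrite mulr_ge0.
have Gub t x : `]s - 1, s + 1[%classic t -> setT x -> `|partial1of2 f t x| <= `|x| * g x.
  move=> _ _; rewrite pf normrN !normrM (ger0_norm (g0 _)).
  by rewrite ler_wpM2r// ler_piMr.
have d := derivable_under_integral measurableT Is intf derf G0 int_norm_g Gub.
have e := differentiation_under_integral measurableT Is intf derf G0 int_norm_g Gub.
apply: DeriveDef; first exact: d.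
rewrite -derive1E; transitivity (\int[mu]_y partial1of2 f s y); first exact: e.
under eq_Rintegral do rewrite pf -mulN1r.
rewrite RintegralZl//; first by rewrite gauss_by_parts mulN1r.
exact: int_boundedM.
Qed.

(** Differentiating under the integral and integrating by parts shows that
    phi' (s) = - sigma^2 s phi (s), whence phi (s) exp (sigma^2 s^2 / 2) is
    constant. *)
Lemma normal_cos_transform (s b : R) :
  \int[mu]_x (cos (s * x + b) * normal_pdf 0 sigma x) =
  cos b * expR (- (sigma ^+ 2 * s ^+ 2 / 2)).
Proof.
pose psi (t : R) := phi b t * expR (sigma ^+ 2 * t ^+ 2 / 2).
have dpsi (t : R) : is_derive t 1 psi 0.
  have dphi := is_derive_phi b t.
  by rewrite /psi; apply: is_derive_eq; rewrite /GRing.scale/=; field.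
have := is_derive_0_is_cst s 0 dpsi.
rewrite /psi expr0n/= mulr0 mul0r expR0 mulr1 => h.
have phi0 : phi b 0 = cos b.
  rewrite /phi; under eq_Rintegral do rewrite mul0r add0r.
  rewrite RintegralZl//.
  by rewrite /Rintegral integral_normal_pdf mulr1.
by rewrite -/(phi b s) expRN -phi0 -h mulfK// gt_eqF// expR_gt0.
Qed.

End normal_cosine_transform.

(** * Recursions driven by independent inputs *)

Section random_recursion.
Context (R : realType) d (T : measurableType d) (P : probability T R).
Context ds (S : measurableType ds).
Variables (X : nat -> {RV P >-> R}) (g : S * R -> S) (s0 : S).
Hypothesis mg : measurable_fun setT g.
Hypothesis indep : mutually_independent X.

Fixpoint chain (n : nat) (w : T) : S :=
  if n is k.+1 then g (chain k w, X k w) else s0.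

Lemma measurable_chain n : measurable_fun setT (chain n).
Proof.
elim: n => [|n IH] /=; first exact: measurable_cst.
by apply: measurableT_comp mg _; exact: measurable_fun_pair.
Qed.

HB.instance Definition _ n :=
  isMeasurableFun.Build _ _ T S (chain n) (measurable_chain n).

Let state_input n (w : T) : S * R := (chain n w, X n w).

Let measurable_state_input n : measurable_fun setT (state_input n).
Proof. by apply: measurable_fun_pair => //; exact: measurable_chain. Qed.

HB.instance Definition _ n :=
  isMeasurableFun.Build _ _ T (S * R)%type (state_input n)
    (@measurable_state_input n).

Let future (J : {fset nat}) (B : nat -> set R) : set T :=
  \bigcap_(i in [set` J]) (X i @^-1` B i).

Let measurable_future J B :
  (forall i, measurable (B i)) -> measurable (future J B).
Proof.
move=> mB; apply: fin_bigcap_measurable; first exact: finite_fset.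
by move=> i _; rewrite -[X in measurable X]setTI; exact: measurable_funPT.
Qed.

Let futureU n J B C : n \notin J ->
  future (n |` J)%fset (fun i => if i == n then C else B i) =
  X n @^-1` C `&` future J B.
Proof.
move=> nJ; apply/seteqP; split=> [w h|w [hC h] i /=].
  split; first by have := h n; rewrite /= in_fset1U eqxx; apply.
  move=> i iJ; have := h i; rewrite /= in_fset1U iJ orbT => /(_ isT).
  by case: eqP => // ein; move: iJ nJ; rewrite /= ein => ->.
rewrite in_fset1U; case: eqP => [-> _ //|_ /= iJ]; exact: h.
Qed.

Let probability_futureU n J B C : n \notin J ->
  (forall i, measurable (B i)) -> measurable C ->
  P (X n @^-1` C `&` future J B) = (P (X n @^-1` C) * P (future J B))%E.
Proof.
move=> nJ mB mC; rewrite -futureU// /future !indep//; last first.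
  by move=> i; case: eqP.
rewrite big_fsetU1//= eqxx; congr (_ * _)%E.
rewrite big_seq [RHS]big_seq; apply: eq_bigr => i iJ.
by case: eqP => // ein; move: iJ nJ; rewrite ein => ->.
Qed.

(** On rectangles the two sides agree by hypothesis.  The event E, which will
    concern later inputs, is carried along because the induction on n needs the
    state to be independent of the whole future. *)
Let product_law n (E : set T) (mE : measurable E) :
  (forall A B, measurable A -> measurable B ->
    P (chain n @^-1` A `&` (X n @^-1` B `&` E)) =
    (P (chain n @^-1` A) * (P (X n @^-1` B) * P E))%E) ->
  forall D : set (S * R), measurable D ->
  P (state_input n @^-1` D `&` E) =
  (P E * (distribution P (chain n) \x distribution P (X n)) D)%E.
Proof.
move=> rect D mD.
pose r := NngNum (pr_ge0 P E).
pose m' := pushforward (mrestr P mE) (state_input n).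
have m'E A B : measurable A -> measurable B ->
    m' (A `*` B) =
    (mscale r (distribution P (chain n)) A * distribution P (X n) B)%E.
  move=> mA mB.
  rewrite /m' /pushforward /mrestr /mscale/= /distribution /pushforward.
  rewrite -prE//.
  rewrite (_ : _ `&` E = chain n @^-1` A `&` (X n @^-1` B `&` E)); last first.
    by rewrite setIA.
  by rewrite rect// muleA muleC muleA.
rewrite -[LHS](@product_measure_unique _ _ _ _ _
  (mscale r (distribution P (chain n))) (distribution P (X n)) m' m'E D mD).
rewrite /product_measure1 ge0_integral_mscale//=; last first.
  exact: measurable_fun_xsection.
by rewrite -prE.
exact: measurable_state_input.
Qed.

Lemma chain_independent_future n (J : {fset nat}) (B : nat -> set R) A :
  (forall i, i \in J -> (n <= i)%N) -> (forall i, measurable (B i)) ->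
  measurable A ->
  P (chain n @^-1` A `&` future J B) =
  (P (chain n @^-1` A) * P (future J B))%E.
Proof.
elim: n J B A => [|n IH] J B A nJ mB mA.
  have [sA|sA] := pselect (A s0).
    rewrite (_ : chain 0 @^-1` A = setT); last by apply/seteqP; split.
    by have := probability_setT P; move=> /= ->; rewrite setTI mul1e.
  rewrite (_ : chain 0 @^-1` A = set0); last by apply/seteqP; split.
  by rewrite set0I measure0 mul0e.
have mD : measurable (g @^-1` A).
  by rewrite -[X in measurable X]setTI; exact: mg.
have rect (K : {fset nat}) : (forall i, i \in K -> (n.+1 <= i)%N) ->
    forall (A B' : set _), measurable A -> measurable B' ->
    P (chain n @^-1` A `&` (X n @^-1` B' `&` future K B)) =
    (P (chain n @^-1` A) * (P (X n @^-1` B') * P (future K B)))%E.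
  move=> nK A' C mA' mC.
  have nnK : n \notin K by apply/negP => /nK; rewrite ltnn.
  rewrite -futureU// IH//; last by move=> i; case: eqP.
    by rewrite futureU// probability_futureU.
  by move=> i; rewrite in_fset1U => /orP[/eqP ->//|/nK/ltnW].
have future0 : future fset0 B = setT.
  by apply/seteqP; split => // w _ i; rewrite /= in_fset0.
rewrite (_ : chain n.+1 @^-1` A = state_input n @^-1` (g @^-1` A))//.
rewrite (product_law (measurable_future J mB) (rect J nJ) mD).
have rect0 := rect fset0; rewrite future0 in rect0.
have := product_law measurableT (rect0 _) mD; rewrite setIT => -> //.
by have := probability_setT P; move=> /= ->; rewrite mul1e muleC.
Qed.

Lemma chain_independent_input n A B : measurable A -> measurable B ->
  P (chain n @^-1` A `&` X n @^-1` B) =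
  (P (chain n @^-1` A) * P (X n @^-1` B))%E.
Proof.
move=> mA mB; have := @chain_independent_future n [fset n]%fset (fun=> B) A.
have -> : future [fset n]%fset (fun=> B) = X n @^-1` B.
  apply/seteqP; split => [w /(_ n)|w wB i /=]; first by apply; rewrite /= in_fset1.
  by rewrite in_fset1 => /eqP ->.
by apply => // i; rewrite in_fset1 => /eqP ->.
Qed.

(** The Markov property: given the past, the next input may be replaced by an
    independent copy.  The copy lives on a second copy of the same space. *)
Lemma chain_decoupling n (F : S * R -> R) (K : R) :
  measurable_fun setT F -> (forall x, `|F x| <= K) ->
  \int[P]_w F (chain n w, X n w) =
  \int[P]_w \int[P]_v F (chain n w, X n v).
Proof.
move=> mF FK.
pose m1 := distribution P (chain n); pose m2 := distribution P (X n).
have law D : measurable D -> distribution P (state_input n) D = (m1 \x m2)%E D.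
  move=> mD; have PT : P setT = 1%E by exact: probability_setT.
  have rect A B : measurable A -> measurable B ->
      P (chain n @^-1` A `&` (X n @^-1` B `&` setT)) =
      (P (chain n @^-1` A) * (P (X n @^-1` B) * P setT))%E.
    by move=> mA mB; rewrite setIT PT mule1; exact: chain_independent_input.
  by have := product_law measurableT rect mD; rewrite setIT PT mul1e.
have intF : (m1 \x m2)%E.-integrable setT (EFin \o F).
  exact: (@bounded_integrable _ _ _
    ((m1 \x m2)%E : probability (S * R)%type R) F K).
have mFs s : measurable_fun setT (fun x => F (s, x)).
  exact: measurableT_comp mF (pair1_measurable s).
transitivity (\int[distribution P (state_input n)]_z F z).
  rewrite /Rintegral integral_distribution//; first exact/measurable_EFinP.
  apply: (@bounded_integrable _ _ _ P (F \o state_input n) K) => [|w]; last exact: FK.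
  exact: measurableT_comp.
transitivity (fine (\int[(m1 \x m2)]_z (F z)%:E)%E).
  by congr fine; apply: eq_measure_integral => D mD _; exact: law.
rewrite -integral12_prod_meas1//.
transitivity (\int[m1]_s \int[P]_v F (s, X n v)).
  congr fine; apply: eq_integral => s _; rewrite /fubini_F.
  rewrite -(@bounded_EFin_Rintegral _ _ _ m2 (fun x => F (s, x)) K)//.
  congr EFin; rewrite /Rintegral integral_distribution//.
    exact/measurable_EFinP.
  apply: (@bounded_integrable _ _ _ P (fun v => F (s, X n v)) K) => [|w]; last exact: FK.
  exact: (measurableT_comp (mFs s)).
pose G (x : S * T) := F (x.1, X n x.2).
have mG : measurable_fun setT G.
  apply: measurableT_comp mF _; apply: measurable_fun_pair => //.
  exact: measurableT_comp.
have mh := measurable_Rintegral_section m1 P mG (fun x => FK _).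
rewrite /Rintegral integral_distribution//; first exact/measurable_EFinP.
apply: (@bounded_integrable _ _ _ P
  (fun w => \int[P]_v F (chain n w, X n v)) K) => [|w].
  exact: (measurableT_comp mh).
apply: bounded_norm_Rintegral => //.
exact: (measurableT_comp (mFs _)).
Qed.

End random_recursion.

(** * Exponential variables *)

Section exponential_variable.
Context (R : realType) d (T : measurableType d) (P : probability T R).
Variables (lambda : R) (lambda0 : 0 < lambda) (X : {RV P >-> R}).
Hypothesis lawX : has_law X (exponential_prob lambda).

Lemma exponential_lawE A : measurable A ->
  P (X @^-1` A) =
  (\int[lebesgue_measure]_(x in A) (exponential_pdf lambda x)%:E)%E.
Proof. exact: lawX. Qed.

Let mX A : measurable A -> measurable (X @^-1` A).
Proof. exact: measurable_RV_preimage. Qed.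

Lemma pr_exponential_le0 : pr P [set w | X w <= 0] = 0.
Proof.
apply/eqP; rewrite eq_le pr_ge0 andbT.
have m0 : measurable (X @^-1` `]-oo, 0[) by exact: mX.
have m1 : measurable (X @^-1` [set 0]) by exact: mX.
apply: (@le_trans _ _ (pr P (X @^-1` `]-oo, 0[) + pr P (X @^-1` [set 0]))).
  apply: pr_leU => // [|w /=]; first exact: measurable_RV_le.
  by rewrite in_itv/= le_eqVlt => /orP[/eqP|]; [right|left].
rewrite /pr !exponential_lawE// integral_set1/= addr0 integral0_eq// => x /=.
by rewrite in_itv/= => x0; rewrite lt0_exponential_pdf.
Qed.

Lemma pr_exponential_gt m : 0 < m ->
  pr P [set w | m < X w] <= expR (- lambda * m).
Proof.
move=> m0; have mm : measurable (X @^-1` `[0, m]) by exact: mX.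
have E : pr P (X @^-1` `[0, m]) = 1 - expR (- lambda * m).
  by rewrite /pr [P _]lawX// exponential_prob_itv0c.
have -> : expR (- lambda * m) = 1 - pr P (X @^-1` `[0, m]) by rewrite E subKr.
rewrite -prC//; apply: pr_le => //; first exact: measurable_RV_gt.
  exact: measurableC.
by move=> w /= mX'; rewrite in_itv/= => /andP[_]; rewrite leNgt mX'.
Qed.

Lemma pr_exponential_le m : 0 < m ->
  pr P [set w | X w <= m] <= 1 - expR (- lambda * m).
Proof.
move=> m0; have mm : measurable (X @^-1` `[0, m]) by exact: mX.
have <- : pr P (X @^-1` `[0, m]) = 1 - expR (- lambda * m).
  by rewrite /pr [P _]lawX// exponential_prob_itv0c.
suff : pr P [set w | X w <= m] <=
    pr P [set w | X w <= 0] + pr P (X @^-1` `[0, m]).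
  by rewrite pr_exponential_le0 add0r.
apply: pr_leU => // [||w /= Xm]; [exact: measurable_RV_le..|].
rewrite in_itv/= Xm andbT.
by have [h|/ltW] := leP (X w) 0; [left|right].
Qed.

Lemma exponential_expectation (f : R -> R) (K : R) :
  measurable_fun setT f -> (forall x, `|f x| <= K) ->
  \int[P]_w f (X w) = \int[lebesgue_measure]_(x in `[0, +oo[)
    (f x * (lambda * expR (- lambda * x))).
Proof.
move=> mf fK; rewrite (Rintegral_RV_density (measurable_exponential_pdf lambda)
  (exponential_pdf_ge0 (ltW lambda0)) exponential_lawE mf fK).
rewrite [RHS]Rintegral_mkcond; apply: eq_Rintegral => x _.
by rewrite /exponential_pdf !patchE; case: ifP; rewrite ?mulr0.
Qed.

End exponential_variable.

(** * Sum of the records below a level *)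

Section truncated_records.
Context (R : realType).
Variable m : R.

(** A state (y, v) is the running maximum y, capped at m, with the sum v of the
    records that do not exceed m.  The cap costs nothing, since no later value
    can contribute once the maximum exceeds m, and it bounds the martingale. *)
Definition record_step (s : (R * R) * R) : R * R :=
  (Num.max s.1.1 (Num.min s.2 m),
   if (s.1.1 < s.2) && (s.2 <= m) then s.1.2 + s.2 else s.1.2).

Lemma measurable_record_step : measurable_fun setT record_step.
Proof.
have m1 : measurable_fun setT (fun s : (R * R) * R => s.1.1).
  by apply: measurableT_comp => //; exact: measurableT_comp.
have m2 : measurable_fun setT (fun s : (R * R) * R => s.1.2).
  by apply: measurableT_comp => //; exact: measurableT_comp.
have m3 : measurable_fun setT (fun s : (R * R) * R => s.2).
  exact: measurable_snd.
apply: measurable_fun_pair.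
  by apply: measurable_maxr => //; exact: measurable_minr.
apply: measurable_fun_ifT => //; last exact: measurable_funD.
by apply: measurable_and; [exact: measurable_fun_ltr|exact: measurable_fun_ler].
Qed.

End truncated_records.

Section record_martingale.
Context (R : realType).
Variables (lambda m theta b : R).
Hypotheses (lambda0 : 0 < lambda) (m0 : 0 <= m) (theta0 : 0 < theta).

(** int_y^m (1 - exp (i theta x)) dx = damping y - i drift y. *)
Definition damping (y : R) := (m - y) - (sin (theta * m) - sin (theta * y)) / theta.
Definition drift (y : R) := (cos (theta * y) - cos (theta * m)) / theta.

(** The conditional expectation of cos (theta A(m) + b) given that the running
    maximum is y and the current sum is v; b is an arbitrary phase, which makes
    real parts suffice. *)
Definition final_cos (y v : R) :=
  expR (- lambda * damping y) * cos (theta * v + lambda * drift y + b).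

(** x - sin (theta x) / theta is nondecreasing. *)
Lemma damping_ge0 y : y <= m -> 0 <= damping y.
Proof.
move=> ym; pose F x := x - sin (theta * x) / theta.
have dF (x : R) : is_derive x 1 F (1 - cos (theta * x)).
  apply: is_derive_eq; rewrite /GRing.scale/=; field; exact: lt0r_neq0.
suff : F y <= F m by rewrite /F /damping mulrBl; lra.
by apply: (is_derive_nondecreasing ym dF) => x _; rewrite subr_ge0 cos_le1.
Qed.

Lemma final_cos_le1 y v : y <= m -> `|final_cos y v| <= 1.
Proof.
move=> ym; rewrite normrM mulr_ile1 ?normr_cos_le1//.
by rewrite ger0_norm ?expR_ge0// -expR0 ler_expR mulNr oppr_le0 mulr_ge0 ?damping_ge0// ltW.
Qed.

Lemma final_cos_top v : final_cos m v = cos (theta * v + b).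
Proof. by rewrite /final_cos /damping /drift !subrr mul0r subr0 !mulr0 expR0 mul1r addr0. Qed.

(** This is the backward equation: integrated over [y, m], it expresses
    conditioning on the next record value. *)
Lemma is_derive_final_cos v (x : R) :
  is_derive x 1 (fun x => - (expR (- lambda * x) * final_cos x v))
    (final_cos x (v + x) * (lambda * expR (- lambda * x))).
Proof.
apply: is_derive_eq; rewrite /GRing.scale/= /final_cos.
rewrite (_ : theta * (v + x) + lambda * drift x + b =
  (theta * v + lambda * drift x + b) + theta * x); last by ring.
rewrite (cosD (_ + b)) /damping /drift.
set A := cos (_ + b); set B := sin (_ + b).
set E := expR (- lambda * (_ - _)).
set E2 := expR (- lambda * x).
by field; exact: lt0r_neq0.
Qed.

Lemma measurable_final_cos : measurable_fun setT (fun s : R * R => final_cos s.1 s.2).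
Proof.
have mdamping : measurable_fun setT damping.
  by apply: continuous_measurable_fun; apply: derivable_continuous => x; exact: ex_derive.
have mdrift : measurable_fun setT drift.
  by apply: continuous_measurable_fun; apply: derivable_continuous => x; exact: ex_derive.
apply: measurable_funM.
  apply: measurableT_comp; first exact: measurable_expR.
  apply: measurable_funM => //.
  exact: measurableT_comp.
apply: measurable_cosM; apply: measurable_funD => //.
apply: measurable_funD; apply: measurable_funM => //.
exact: measurableT_comp.
Qed.

Lemma measurable_fun_final_cos (d : measure_display) (T : measurableType d)
    (u v : T -> R) : measurable_fun setT u -> measurable_fun setT v ->
  measurable_fun setT (fun x => final_cos (u x) (v x)).
Proof.
by move=> mu mv; exact: measurableT_comp measurable_final_cos (measurable_fun_pair mu mv).
Qed.

Let rate (x : R) := lambda * expR (- lambda * x).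

Let rate_ge0 x : 0 <= rate x.
Proof. by rewrite mulr_ge0 ?expR_ge0 ?ltW. Qed.

Let is_derive_rate (x : R) : is_derive x 1 (fun x => - expR (- lambda * x)) (rate x).
Proof. by apply: is_derive_eq; rewrite /GRing.scale/= /rate; ring. Qed.

Let continuous_rate : continuous rate.
Proof. by apply: derivable_continuous => x; exact: ex_derive. Qed.

Let cvg_rate : (- expR (- lambda * x)) @[x --> +oo] --> (0 : R).
Proof. by rewrite -[X in _ --> X]oppr0; apply: cvgN; exact: cvgr_expRM. Qed.

Let integrable_bounded_rate (f : R -> R) : measurable_fun setT f ->
  (forall x, `|f x| <= 1) ->
  lebesgue_measure.-integrable `[0, +oo[ (EFin \o (fun x => f x * rate x)).
Proof.
move=> mf f1.
have mr : measurable_fun setT rate by exact: continuous_measurable_fun.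
apply: (@le_integrable _ _ _ lebesgue_measure _ _ _
    (EFin \o exponential_pdf lambda)) => //.
- by apply/measurable_EFinP; apply: measurable_funTS; exact: measurable_funM.
- move=> x /=; rewrite in_itv/= andbT => x0.
  rewrite lee_fin exponential_pdfE// normrM.
  by rewrite [leRHS](_ : _ = `|rate x|)// ler_piMl.
- apply: integrableS (integrable_exponential_pdf lambda0) => //.
Qed.

(** The next lifetime x leaves the state alone when x <= y, moves it to (x, v + x)
    when y < x <= m, and to (m, v) when x > m; the primitive found in
    is_derive_final_cos makes the three contributions telescope. *)
Lemma record_step_final_cos (d : measure_display) (T : measurableType d)
    (P : probability T R) (X : {RV P >-> R}) (y v : R) :
  has_law X (exponential_prob lambda) -> 0 <= y -> y <= m ->
  \int[P]_w final_cos (Num.min (record_step m ((y, v), X w)).1 m)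
                 (record_step m ((y, v), X w)).2 = final_cos y v.
Proof.
move=> lawX y0 ym.
pose f x := final_cos (Num.min (record_step m ((y, v), x)).1 m)
                 (record_step m ((y, v), x)).2.
have mf : measurable_fun setT f.
  have mr : measurable_fun setT (fun x : R => record_step m ((y, v), x)).
    exact: measurableT_comp (measurable_record_step m) (pair1_measurable (y, v)).
  apply: measurable_fun_final_cos; last exact: (measurableT_comp measurable_snd mr).
  apply: measurable_minr => //; exact: (measurableT_comp measurable_fst mr).
have f1 x : `|f x| <= 1 by rewrite final_cos_le1// ge_min lexx orbT.
rewrite (exponential_expectation lambda0 lawX mf f1) -/rate.
have intf := integrable_bounded_rate mf f1.
have int1 : lebesgue_measure.-integrable `[0, +oo[ (EFin \o rate).
  have h : measurable_fun setT (fun _ : R => 1 : R) by [].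
  have := integrable_bounded_rate h => /(_ _)/= => h2.
  have := h2 (fun _ => ltac:(by rewrite normr1)).
  by apply: eq_integrable => // x _ /=; rewrite mul1r.
have := @Rintegral_itvB _ (fun x => f x * rate x) (BLeft 0) (BInfty _ false) y intf.
rewrite !bnd_simp => /(_ y0 isT) /eqP; rewrite subr_eq => /eqP ->.
have intf' : lebesgue_measure.-integrable `]y, +oo[ (EFin \o (fun x => f x * rate x)).
  by apply: integrableS intf => // x /=; rewrite !in_itv/= !andbT => /ltW; exact: le_trans.
have := @Rintegral_itvB _ (fun x => f x * rate x) (BRight y) (BInfty _ false) m intf'.
rewrite !bnd_simp => /(_ ym isT) /eqP; rewrite subr_eq => /eqP ->.
have -> : \int[lebesgue_measure]_(x in `[0, y]) (f x * rate x) =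
    final_cos y v * (1 - expR (- lambda * y)).
  transitivity (\int[lebesgue_measure]_(x in `[0, y]) (final_cos y v * rate x)).
    apply: eq_Rintegral => x; rewrite inE/= in_itv/= => /andP[_ xy].
    rewrite /f /record_step/= ltNge xy/=.
    by rewrite (min_idPl (le_trans xy ym)) (max_idPl xy) (min_idPl ym).
  rewrite RintegralZl//; last first.
    by apply: integrableS int1 => // x /=; rewrite !in_itv/= andbT => /andP[].
  rewrite (is_derive_FTC_le y0 is_derive_rate)//.
  by rewrite mulr0 expR0 opprK addrC.
have -> : \int[lebesgue_measure]_(x in `]y, m]) (f x * rate x) =
    expR (- lambda * y) * final_cos y v - expR (- lambda * m) * final_cos m v.
  have cg : continuous (fun x => final_cos x (v + x) * rate x).
    by apply: derivable_continuous => x; exact: ex_derive.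
  transitivity (\int[lebesgue_measure]_(x in `]y, m]) (final_cos x (v + x) * rate x)).
    apply: eq_Rintegral => x; rewrite inE/= in_itv/= => /andP[yx xm].
    rewrite /f /record_step/= yx xm/=.
    by rewrite (min_idPl xm) (max_idPr (ltW yx)) (min_idPl xm).
  rewrite Rintegral_itv_obnd_cbnd; last first.
    have icc : lebesgue_measure.-integrable `[y, m]
        (EFin \o (fun x => final_cos x (v + x) * rate x)).
      apply: continuous_compact_integrable; first exact: segment_compact.
      exact: continuous_subspaceT.
    by apply: integrableS icc => //; exact: subset_itv_oc_cc.
  by rewrite (is_derive_FTC_le ym (is_derive_final_cos v))// opprK addrC.
have -> : \int[lebesgue_measure]_(x in `]m, +oo[) (f x * rate x) =
    expR (- lambda * m) * final_cos m v.
  have int2 : lebesgue_measure.-integrable `]m, +oo[ (EFin \o rate).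
    by apply: integrableS int1 => // x /=; rewrite !in_itv/= !andbT => /ltW; exact: le_trans.
  transitivity (\int[lebesgue_measure]_(x in `]m, +oo[) (final_cos m v * rate x)).
    apply: eq_Rintegral => x; rewrite inE/= in_itv/= andbT => mx.
    rewrite /f /record_step/= [x <= m]leNgt mx andbF.
    by rewrite (min_idPr (ltW mx)) (max_idPr ym) minxx.
  rewrite RintegralZl// Rintegral_itv_obnd_cbnd//.
  rewrite (is_derive_ge0_FTCy (fun x _ => rate_ge0 x) is_derive_rate continuous_rate cvg_rate).
  by rewrite opprK add0r mulrC.
ring.
Qed.

End record_martingale.

Section record_chain.
Context (R : realType) d (T : measurableType d) (P : probability T R).
Variables (lambda : R) (X : nat -> {RV P >-> R}).
Hypothesis lambda0 : 0 < lambda.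
Hypothesis indep : mutually_independent X.
Hypothesis lawX : forall k, has_law (X k) (exponential_prob lambda).

Section fixed_level.
Variables (m : R) (m0 : 0 < m).

Definition record_chain := chain X (record_step m) (0, 0).

Lemma measurable_record_chain n : measurable_fun setT (record_chain n).
Proof. by apply: measurable_chain; exact: measurable_record_step. Qed.

Lemma record_chain_level_bounds n w :
  0 <= (record_chain n w).1 <= m.
Proof.
elim: n => [|n /andP[y0 ym]] /=; first by rewrite lexx ltW.
by rewrite /record_step/= le_max y0 ge_max ym ge_min lexx orbT.
Qed.

Lemma expectation_record_chain_final_cos (theta b : R) n : 0 < theta ->
  \int[P]_w final_cos lambda m theta b (record_chain n w).1 (record_chain n w).2 =
  final_cos lambda m theta b 0 0.
Proof.
move=> theta0; elim: n => [|n IH]; first exact: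
  (Rintegral_prob_cst P (final_cos lambda m theta b 0 0)).
(* The minimum is inert on reachable states; it makes F bounded everywhere. *)
pose F (s : (R * R) * R) := final_cos lambda m theta b
  (Num.min (record_step m s).1 m) (record_step m s).2.
have mF : measurable_fun setT F.
  have mr := measurable_record_step m.
  apply: measurable_fun_final_cos => //; last exact: (measurableT_comp measurable_snd mr).
  by apply: measurable_minr => //; exact: (measurableT_comp measurable_fst mr).
have F1 s : `|F s| <= 1 by rewrite final_cos_le1// ge_min lexx orbT.
transitivity (\int[P]_w F (record_chain n w, X n w)).
  apply: eq_Rintegral => w _; have := record_chain_level_bounds n.+1 w.
  by rewrite /F/= => /andP[_ /min_idPl ->].
rewrite (chain_decoupling ((0, 0) : (R * R)%type) (@measurable_record_step R m) indep n mF F1) -IH.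
apply: eq_Rintegral => w _; have /andP[y0 ym] := record_chain_level_bounds n w.
rewrite -(record_step_final_cos b lambda0 (ltW m0) theta0 _ (lawX n) y0 ym).
by apply: eq_Rintegral => v _; rewrite /F -surjective_pairing.
Qed.

(** The level stays below m only if all n lifetimes do, which has probability
    (1 - exp (- lambda m))^n. *)
Lemma pr_record_chain_level n :
  pr P [set w | (record_chain n w).1 < m] <=
  expR (- (n%:R * expR (- lambda * m))).
Proof.
have mA : measurable [set s : R * R | s.1 < m].
  rewrite -[X in measurable X]setTI.
  have := @measurable_fun_ltr _ _ _ setT (fst : R * R -> R) (cst m).
  by move=> /(_ _ _ measurableT [set true]); apply.
have mE k : measurable [set w | (record_chain k w).1 < m].
  rewrite -[X in measurable X]setTI.
  exact: (measurable_record_chain k measurableT mA).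
elim: n => [|n IH].
  by rewrite mul0r oppr0 expR0 -(prT P); apply: pr_le.
have mXm := measurable_RV_le (X n) m.
have mB : measurable `]-oo, m] by [].
have XE : [set w | X n w <= m] = X n @^-1` `]-oo, m].
  by apply/seteqP; split => w /=; rewrite in_itv.
apply: (@le_trans _ _ (pr P ([set w | (record_chain n w).1 < m] `&`
    [set w | X n w <= m]))).
  apply: pr_le => //; first exact: measurableI.
  move=> w /=; rewrite /record_step/= gt_max gt_min ltxx orbF => /andP[? /ltW].
  by [].
have := chain_independent_input ((0, 0) : (R * R)%type) (@measurable_record_step R m) indep n mA mB.
rewrite -XE -[X in (X * _)%E]/(P [set w | (record_chain n w).1 < m]).
rewrite (prE P (mE n)) (prE P mXm) -EFinM.
rewrite (_ : _ @^-1` _ = [set w | (record_chain n w).1 < m])//.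
move=> /(congr1 fine); rewrite -/(pr P _) => -> /=.
rewrite -natr1 mulrDl mul1r opprD expRD ler_pM ?pr_ge0//.
apply: (le_trans (pr_exponential_le (lawX n) m0)).
exact: expR_ge1Dx.
Qed.

(** At level m the martingale is the cosine itself; elsewhere the two differ by at
    most 2. *)
Lemma record_chain_cos (theta b : R) n : 0 < theta ->
  `|\int[P]_w cos (theta * (record_chain n w).2 + b) - final_cos lambda m theta b 0 0|
  <= 2 * expR (- (n%:R * expR (- lambda * m))).
Proof.
move=> theta0; rewrite -(expectation_record_chain_final_cos b n theta0).
have mc := measurable_record_chain n.
have mcos : measurable_fun setT
    (fun w => cos (theta * (record_chain n w).2 + b)).
  apply: measurable_cosM; apply: measurable_funD => //.
  by apply: measurable_funM => //; exact: measurableT_comp.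
have mm : measurable_fun setT
    (fun w => final_cos lambda m theta b (record_chain n w).1 (record_chain n w).2).
  by apply: measurable_fun_final_cos => //; exact: measurableT_comp.
have m1 w : `|final_cos lambda m theta b (record_chain n w).1 (record_chain n w).2| <= 1.
  by apply: final_cos_le1 => //; have /andP[] := record_chain_level_bounds n w.
have i1 := bounded_integrable P mcos (fun w => normr_cos_le1 _).
have i2 := bounded_integrable P mm m1.
rewrite -RintegralB//.
set A := [set w | (record_chain n w).1 < m].
have mA : measurable A.
  rewrite -[X in measurable X]setTI.
  have := @measurable_fun_ltr _ _ _ setT (fun w => (record_chain n w).1) (cst m).
  move=> /(_ _ _ measurableT [set true]); apply => //.
  exact: measurableT_comp.
have mA1 : measurable_fun setT (\1_A : T -> R) by exact: measurable_indic.
have iA : P.-integrable setT (EFin \o (\1_A : T -> R)).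
  apply: (@bounded_integrable _ _ _ P _ 1) => // w.
  by rewrite indicE ger0_norm// lern1; case: (_ \in _).
have iB : P.-integrable setT (EFin \o (fun w => cos (theta * (record_chain n w).2 + b) -
    final_cos lambda m theta b (record_chain n w).1 (record_chain n w).2)).
  apply: (@bounded_integrable _ _ _ P _ 2) => [|w]; first exact: measurable_funB.
  by rewrite (le_trans (ler_normB _ _))// -[leRHS]/(1 + 1) lerD// normr_cos_le1.
apply: le_trans (le_normr_Rintegral measurableT iB) _.
apply: (@le_trans _ _ (\int[P]_w (2 * \1_A w))).
  apply: le_Rintegral => //.
  - exact: integrable_norm.
  - apply: (@bounded_integrable _ _ _ P _ 2) => [|w]; first exact: measurable_funM.
    by rewrite indicE; case: (_ \in _); rewrite ?mulr1 ?mulr0 ?normr0// ger0_norm.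
  - move=> w _; rewrite indicE; case: (boolP (w \in A)) => [_|].
      rewrite mulr1 (le_trans (ler_normB _ _))// -[leRHS]/(1 + 1).
      by rewrite lerD// normr_cos_le1.
    rewrite notin_setE /A/= => /negP; rewrite -leNgt mulr0 => my.
    have /andP[_ ym] := record_chain_level_bounds n w.
    have -> : (record_chain n w).1 = m by apply/eqP; rewrite eq_le ym my.
    by rewrite final_cos_top subrr normr0.
rewrite RintegralZl// Rintegral_indic_pr// ler_pM2l//.
exact: pr_record_chain_level.
Qed.

End fixed_level.

Lemma pr_exists_gt n m : 0 < m ->
  pr P [set w | exists2 k, (k < n)%N & m < X k w] <= n%:R * expR (- lambda * m).
Proof.
move=> m0; have mE k : measurable [set w | exists2 j, (j < k)%N & m < X j w].
  rewrite (_ : mkset _ = \bigcup_(j in [set j | (j < k)%N]) [set w | m < X j w]).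
    by apply: bigcup_measurable => j _; exact: measurable_RV_gt.
  by apply/seteqP; split => w [j ? ?]; exists j.
elim: n => [|n IH].
  rewrite (_ : mkset _ = set0) ?mul0r /pr ?measure0//.
  by apply/seteqP; split => w // [].
rewrite -natr1 mulrDl mul1r.
apply: le_trans (lerD IH (pr_exponential_gt (lawX n) m0)).
apply: pr_leU => //; first exact: measurable_RV_gt.
move=> w [k /=]; rewrite ltnS leq_eqVlt => /orP[/eqP ->|kn] h; first by right.
by left; exists k.
Qed.

Lemma pr_exists_le0 : pr P [set w | exists k, X k w <= 0] = 0.
Proof.
rewrite (_ : mkset _ = \bigcup_k [set w | X k w <= 0]); last first.
  by apply/seteqP; split => w [k]; exists k.
apply/eqP; rewrite eq_le pr_ge0 andbT -lee_fin -prE; last first.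
  by apply: bigcup_measurable => j _; exact: measurable_RV_le.
have mX k : measurable [set w | X k w <= 0] by exact: measurable_RV_le.
have := @generalized_Boole_inequality _ _ _ P _ mX (bigcupT_measurable _ mX).
move=> /le_trans; apply.
rewrite eseries0// => k _ _.
by have := prE P (mX k); rewrite (pr_exponential_le0 (lawX k)).
Qed.

(** Positive parts make exp (- positive_sum) bounded by 1 on the whole space; on
    the almost sure event that all lifetimes are positive this is the arrival
    time. *)
Definition positive_sum := chain X (fun s : R * R => s.1 + Num.max 0 s.2) 0.

Lemma positive_sum_ge0 n w : 0 <= positive_sum n w.
Proof. by elim: n => //= n IH; rewrite addr_ge0// le_max lexx. Qed.

(** Markov's inequality for exp (- S), whose factors have mean
    lambda / (lambda + 1). *)
Lemma pr_positive_sum_le n (t : R) :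
  pr P [set w | positive_sum n w <= t] <=
  expR t * (lambda / (lambda + 1)) ^+ n.
Proof.
pose g (s : R * R) := s.1 + Num.max 0 s.2.
have mg : measurable_fun setT g by apply: measurable_funD => //; exact: measurable_maxr.
have ms k : measurable_fun setT (positive_sum k) by exact: measurable_chain.
have l10 : 0 < lambda + 1 by rewrite addr_gt0.
have Eexp k : \int[P]_w expR (- Num.max 0 (X k w)) = lambda / (lambda + 1).
  rewrite (@exponential_expectation _ _ _ P _ lambda0 _ (lawX k)
    (fun x => expR (- Num.max 0 x)) 1); last 2 first.
  - apply: measurableT_comp; first exact: measurable_expR.
    by apply: measurableT_comp => //; exact: measurable_maxr.
  - move=> x; rewrite ger0_norm ?expR_ge0// -expR0 ler_expR oppr_le0.
    by rewrite le_max lexx.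
  pose f (x : R) := lambda * expR (- (lambda + 1) * x).
  transitivity (\int[lebesgue_measure]_(x in `[0, +oo[) f x).
    apply: eq_Rintegral => x; rewrite inE/= in_itv/= andbT => x0.
    by rewrite (max_idPr x0) mulrCA -expRD /f; congr (_ * expR _); ring.
  pose F (x : R) := - (lambda / (lambda + 1)) * expR (- (lambda + 1) * x).
  have dF (x : R) : is_derive x 1 F (f x).
    by apply: is_derive_eq; rewrite /GRing.scale/= /f; field; exact: lt0r_neq0.
  have f0 x : 0 <= x -> 0 <= f x by rewrite mulr_ge0 ?expR_ge0// ltW.
  have cf : continuous f by apply: derivable_continuous => x; exact: ex_derive.
  have Fl : F x @[x --> +oo] --> 0.
    rewrite -[X in _ --> X](mulr0 (- (lambda / (lambda + 1)))).
    by apply: cvgMl_tmp; exact: cvgr_expRM.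
  by rewrite (is_derive_ge0_FTCy f0 dF cf Fl) /F mulr0 expR0; ring.
have mexp k : measurable_fun setT (fun w => expR (- positive_sum k w)).
  by apply: measurableT_comp; [exact: measurable_expR|exact: measurableT_comp].
have exp1 k w : `|expR (- positive_sum k w)| <= 1.
  by rewrite ger0_norm ?expR_ge0// -expR0 ler_expR oppr_le0 positive_sum_ge0.
have laplace k : \int[P]_w expR (- positive_sum k w) = (lambda / (lambda + 1)) ^+ k.
  elim: k => [|k IH].
    rewrite expr0 -[RHS](Rintegral_prob_cst P); apply: eq_Rintegral => w _.
    by rewrite oppr0 expR0.
  pose F (s : R * R) := expR (- Num.max 0 (g s)).
  have mF : measurable_fun setT F.
    apply: measurableT_comp; first exact: measurable_expR.
    by apply: measurableT_comp => //; exact: measurable_maxr.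
  have F1 s : `|F s| <= 1.
    rewrite ger0_norm ?expR_ge0// -expR0 ler_expR oppr_le0.
    by rewrite le_max lexx.
  transitivity (\int[P]_w F (positive_sum k w, X k w)).
    apply: eq_Rintegral => w _.
    by rewrite /F (max_idPr _)//; exact: (positive_sum_ge0 k.+1 w).
  rewrite (chain_decoupling (0 : R) mg indep k mF F1).
  rewrite exprSr -IH -RintegralZr//; last exact: bounded_integrable (exp1 k).
  apply: eq_Rintegral => w _; rewrite -(Eexp k) -RintegralZl//; last first.
    apply: (@bounded_integrable _ _ _ P _ 1) => [|v].
      apply: measurableT_comp; first exact: measurable_expR.
      by apply: measurableT_comp => //; exact: measurable_maxr.
    rewrite ger0_norm ?expR_ge0// -expR0 ler_expR oppr_le0.
    by rewrite le_max lexx.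
  apply: eq_Rintegral => v _; rewrite -expRD -opprD /F (max_idPr _)//.
  by rewrite /g/= addr_ge0 ?positive_sum_ge0// le_max lexx.
set A := [set w | _ <= t].
have mA : measurable A.
  rewrite -[X in measurable X]setTI.
  have := @measurable_fun_ler _ _ _ setT (positive_sum n) (cst t).
  by move=> /(_ _ _ measurableT [set true]); apply.
rewrite -laplace -RintegralZl//; last exact: bounded_integrable (exp1 n).
rewrite -Rintegral_indic_pr//; apply: le_Rintegral => //.
- apply: (@bounded_integrable _ _ _ P _ 1) => [|w]; first exact: measurable_indic.
  by rewrite indicE ger0_norm// lern1; case: (_ \in _).
- apply: (@bounded_integrable _ _ _ P _ (expR t)) => [|w]; first exact: measurable_funM.
  by rewrite normrM (ger0_norm (expR_ge0 t)) ler_piMr ?expR_ge0.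
- move=> w _; rewrite indicE; case: (boolP (w \in A)) => [|_]; last first.
    by rewrite mulr_ge0 ?expR_ge0.
  rewrite inE /A/= => wt; rewrite -expRD -[leLHS]expR0 ler_expR.
  by rewrite subr_ge0.
Qed.

End record_chain.

(** * Sandwich along a sample path *)

Section sample_path.
Context (R : realType) d (T : measurableType d) (P : probability T R).
Variables (X : nat -> {RV P >-> R}) (w : T).
Hypothesis X_gt0 : forall k, 0 < X k w.

Lemma record_indicatorE n :
  record_indicator X n w = [forall k : 'I_n, X k w < X n w]%:R.
Proof.
rewrite /record_indicator; case: forallP => [h|/forallP].
  by rewrite big1// => k _; rewrite indicE mem_set//=; exact: h.
rewrite negb_forall => /existsP[k hk]; rewrite (bigD1 k)//= indicE memNset ?mul0r//.
by move=> /=; apply/negP.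
Qed.

Lemma record_indicator_le1 n : record_indicator X n w <= 1.
Proof. by rewrite record_indicatorE lern1; case: [forall _, _]. Qed.

Definition record_sum n := \sum_(k < n) record_indicator X k w * X k w.

(** For x <= m, capping the maximum at m does not affect the comparison with x:
    the chain recognizes as records exactly the records that do not exceed m. *)
Lemma record_chain_level_ltP m n x : 0 < x -> x <= m ->
  ((record_chain X m n w).1 < x) = [forall k : 'I_n, X k w < x].
Proof.
move=> x0 xm; elim: n => [|n IH] /=.
  by rewrite x0; apply/esym/forallP => -[].
rewrite /record_step/= gt_max gt_min [m < x]ltNge xm orbF -/(record_chain X m) IH.
apply/andP/forallP => [[/forallP h hn] k|h].
  by have [/ltnSE] := ltn_ord k; rewrite leq_eqVlt => /orP[/eqP ->//|kn];
     exact: (h (Ordinal kn)).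
split; last exact: (h ord_max).
by apply/forallP => k; exact: (h (widen_ord (leqnSn n) k)).
Qed.

Lemma record_chainS m n : (record_chain X m n.+1 w).2 =
  (record_chain X m n w).2 +
  (if X n w <= m then record_indicator X n w * X n w else 0).
Proof.
rewrite /= /record_step/= -/(record_chain X m).
have [Xm|Xm] := leP (X n w) m; last by rewrite andbF addr0.
rewrite andbT record_chain_level_ltP// record_indicatorE.
by case: [forall _, _]; rewrite ?mul1r// mul0r addr0.
Qed.

Lemma record_sumS n :
  record_sum n.+1 = record_sum n + record_indicator X n w * X n w.
Proof. by rewrite /record_sum big_ord_recr. Qed.

Lemma record_chain_le_record_sum m n : (record_chain X m n w).2 <= record_sum n.
Proof.
elim: n => [|n IH]; first by rewrite /record_sum big_ord0.
rewrite record_chainS record_sumS lerD//; case: ifP => // _.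
by rewrite mulr_ge0 ?record_indicator_ge0// ltW.
Qed.

Lemma record_chain_eq_record_sum m n : (forall k, (k < n)%N -> X k w <= m) ->
  (record_chain X m n w).2 = record_sum n.
Proof.
elim: n => [|n IH] h; first by rewrite /record_sum big_ord0.
by rewrite record_chainS record_sumS h// IH// => k kn; apply: h; exact: ltnW.
Qed.

Lemma record_chain_nondecreasing m n n' : (n <= n')%N ->
  (record_chain X m n w).2 <= (record_chain X m n' w).2.
Proof.
move=> /subnK <-; elim: (n' - n)%N => // k IH; rewrite addSn record_chainS.
apply: (le_trans IH); rewrite lerDl; case: ifP => // _.
by rewrite mulr_ge0 ?record_indicator_ge0// ltW.
Qed.

Lemma arrival_timeS n : arrival_time X n.+1 w = arrival_time X n w + X n w.
Proof. by rewrite /arrival_time big_ord_recr. Qed.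

Lemma arrival_time0 : arrival_time X 0 w = 0.
Proof. by rewrite /arrival_time big_ord0. Qed.

Lemma arrival_time_nondecreasing n n' : (n <= n')%N ->
  arrival_time X n w <= arrival_time X n' w.
Proof.
move=> /subnK <-; elim: (n' - n)%N => // k IH.
by rewrite addSn arrival_timeS (le_trans IH)// lerDl ltW.
Qed.

Lemma arrival_time_ge0 n : 0 <= arrival_time X n w.
Proof. by rewrite -arrival_time0 arrival_time_nondecreasing. Qed.

Lemma arrival_time_positive_sum n : arrival_time X n w = positive_sum X n w.
Proof.
elim: n => [|n IH]; first exact: arrival_time0.
by rewrite arrival_timeS/= IH (max_idPr (ltW (X_gt0 n))).
Qed.

Lemma arrival_time_le m n : (forall k, (k < n)%N -> X k w <= m) ->
  arrival_time X n w <= n%:R * m.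
Proof.
elim: n => [|n IH] h; first by rewrite arrival_time0 mul0r.
rewrite arrival_timeS -natr1 mulrDl mul1r lerD ?h//.
by apply: IH => k kn; apply: h; exact: ltnW.
Qed.

Lemma counting_process_between n s :
  arrival_time X n w <= s < arrival_time X n.+1 w -> counting_process X s w = n.
Proof.
move=> /andP[ns sn]; apply/counting_processE; left.
split=> [k /= ks|k /= ubk]; last exact: ubk.
rewrite leNgt; apply/negP => nk.
have := lt_le_trans sn (arrival_time_nondecreasing nk).
by rewrite ltNge ks.
Qed.

Let I (s : R) := record_indicator X (counting_process X s w) w.

Let measurable_I : measurable_fun setT I.
Proof.
exact: measurableT_comp (measurable_record_indicator_counting_process X)
  (pair1_measurable w).
Qed.

Let I_ge0 s : 0 <= I s. Proof. exact: record_indicator_ge0. Qed.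

Let integrable_I (b1 b2 : bool) (x y : R) :
  lebesgue_measure.-integrable [set` Interval (BSide b1 x) (BSide b2 y)]
    (EFin \o I).
Proof.
apply: measurable_bounded_integrable => //.
- have h : (@lebesgue_measure R
      [set` Interval (BSide b1 x) (BSide b2 y)] < +oo)%E.
    by rewrite lebesgue_measure_itv/=; case: ifP => _; rewrite ltry.
  exact: h.
- exact: measurable_funTS.
- exists 1; split; first exact: num_real.
  move=> M M1 s _; have I1 : `|I s| <= 1.
    by rewrite ger0_norm// record_indicator_le1.
  exact: le_trans I1 (ltW M1).
Qed.

(** Between the n-th and the next arrival the integrand is the n-th record
    indicator, over an interval whose length is the n-th lifetime. *)
Lemma record_time_arrival n :
  \int[lebesgue_measure]_(s in `[0, arrival_time X n w[) I s = record_sum n.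
Proof.
elim: n => [|n IH].
  by rewrite arrival_time0 set_itvco0 Rintegral_set0 /record_sum big_ord0.
have h0 := arrival_time_ge0 n.
have h1 : arrival_time X n w <= arrival_time X n.+1 w.
  exact: arrival_time_nondecreasing.
rewrite record_sumS -IH.
rewrite (@itv_bndbnd_setU _ _ (BLeft 0) (BLeft (arrival_time X n w))) ?bnd_simp//.
rewrite Rintegral_setU//=; last 2 first.
- rewrite -itv_bndbnd_setU ?bnd_simp//; exact: integrable_I.
- apply/disj_setPS => s [/=]; rewrite !in_itv/= => /andP[_ h] /andP[].
  by rewrite leNgt h.
congr (_ + _).
transitivity (\int[lebesgue_measure]_(s in `[arrival_time X n w, arrival_time X n.+1 w[)
  record_indicator X n w).
  apply: eq_Rintegral => s; rewrite inE/= in_itv/= => hs.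
  by rewrite /I (counting_process_between hs).
rewrite Rintegral_cst//.
have L : (@lebesgue_measure R
    `[arrival_time X n w, arrival_time X n.+1 w[ = (X n w)%:E)%E.
  rewrite lebesgue_measure_itv/= lte_fin arrival_timeS.
  by rewrite ltrDl X_gt0/= -EFinD addrAC subrr add0r.
by congr (_ * _); exact: (congr1 fine L).
Qed.

Let le_Rintegral_I (A B : set R) : measurable A -> measurable B ->
  lebesgue_measure.-integrable B (EFin \o I) -> A `<=` B ->
  \int[lebesgue_measure]_(s in A) I s <= \int[lebesgue_measure]_(s in B) I s.
Proof.
move=> mA mB iB AB; rewrite /Rintegral fine_le//.
- by apply: integrable_fin_num => //; exact: integrableS iB.
- exact: integrable_fin_num.
- apply: ge0_subset_integral => //; first exact/measurable_EFinP/measurable_funTS.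
  by move=> s _; rewrite lee_fin.
Qed.

Lemma record_sum_le_record_time n t :
  arrival_time X n w <= t -> record_sum n <= record_time X t w.
Proof.
move=> nt; rewrite -record_time_arrival; apply: le_Rintegral_I => //.
by move=> s /=; rewrite !in_itv/= => /andP[-> /ltW /le_trans]; apply.
Qed.

Lemma record_time_le_record_sum n t :
  t < arrival_time X n w -> record_time X t w <= record_sum n.
Proof.
move=> nt; rewrite -record_time_arrival; apply: le_Rintegral_I => //.
by move=> s /=; rewrite !in_itv/= => /andP[-> /le_lt_trans]; apply.
Qed.

End sample_path.

(** * Asymptotics *)

Section martingale_limit.
Context (R : realType).
Variables (lambda s c beta : R) (lambda0 : 0 < lambda) (s0 : 0 < s).
Variables (sg : nat -> R) (sg_gt0 : forall k, 0 < sg k).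
Hypothesis sg_cvg : sg k @[k --> \oo] --> +oo.

(** In terms of u = 1 / sg, which tends to 0, the argument z = theta m is
    (s / lambda) u^2 r with r = 1 + 2 c u^3; the Taylor bounds of sine and cosine
    then become polynomials in u. *)
Let m k := (sg k ^+ 4 + 2 * c * sg k) / lambda.
Let theta k := s / sg k ^+ 6.
Let u k := (sg k)^-1.
Let z k := theta k * m k.
Let r k := 1 + 2 * c * u k ^+ 3.

Let u_gt0 k : 0 < u k. Proof. by rewrite invr_gt0. Qed.

Let u_cvg : u k @[k --> \oo] --> 0.
Proof. by apply/gtr0_cvgV0 => //; exact: nearW. Qed.

Let sgE k : sg k = (u k)^-1. Proof. by rewrite invrK. Qed.

Let zE k : z k = s / lambda * u k ^+ 2 * r k.
Proof.
rewrite /z /m /theta /r sgE; field.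
by rewrite (gt_eqF (u_gt0 k)) (gt_eqF lambda0).
Qed.

Let comp_cvg (p : R -> R) : (forall x : R, derivable p x 1) ->
  p (u k) @[k --> \oo] --> p 0.
Proof.
move=> dp; apply: (@continuous_cvg _ _ _ _ _ u p 0) => //.
exact: derivable_continuous.
Qed.

Let near_z_ge0 : \forall k \near \oo, 0 <= z k.
Proof.
have rc : r k @[k --> \oo] --> (1 : R).
  rewrite [X in _ --> X](_ : _ = 1 + 2 * c * 0 ^+ 3); last by rewrite expr0n/= mulr0 addr0.
  by apply: (@comp_cvg (fun x => 1 + 2 * c * x ^+ 3)) => x; exact: ex_derive.
have : \forall k \near \oo, 0 <= r k by apply: (cvgr_ge _ rc); exact: ltr01.
apply: filterS => k rk; rewrite zE mulr_ge0// mulr_ge0 ?sqr_ge0// divr_ge0 ?(ltW s0) ?(ltW lambda0)//.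
Qed.

(** lambda damping = (lambda / theta) (z - sin z), close to
    lambda theta^2 m^3 / 6, whose limit is s^2 / 2 times the variance of the
    limit law. *)
Lemma damping_cvg : lambda * damping (m k) (theta k) 0 @[k --> \oo] -->
  s ^+ 2 / (6 * lambda ^+ 2).
Proof.
pose p (x : R) := s ^+ 2 / (6 * lambda ^+ 2) * (1 + 2 * c * x ^+ 3) ^+ 3.
pose q (x : R) := p x -
  s ^+ 4 / (120 * lambda ^+ 4) * x ^+ 4 * (1 + 2 * c * x ^+ 3) ^+ 5.
have E k : lambda * damping (m k) (theta k) 0 =
    lambda / (s * u k ^+ 6) * (z k - sin (z k)).
  have -> : u k ^+ 6 = (sg k ^+ 6)^-1 by rewrite exprVn.
  rewrite /damping mulr0 sin0 -/(z k) !subr0 /z /theta; field.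
  by rewrite !gt_eqF ?exprn_gt0.
have L k : 0 < lambda / (s * u k ^+ 6) by rewrite divr_gt0// mulr_gt0 ?exprn_gt0.
apply: (@squeeze_cvgr _ _ _ _ (q \o u) (p \o u)).
- near=> k; have zk : 0 <= z k by near: k; exact: near_z_ge0.
  rewrite E /=; apply/andP; split.
    rewrite (_ : q (u k) = lambda / (s * u k ^+ 6) * (z k ^+ 3 / 6 - z k ^+ 5 / 120)).
      by rewrite ler_pM2l//; have := sin_le5 zk; lra.
    rewrite /q /p zE /r; field.
    by rewrite (gt_eqF (u_gt0 k)) (gt_eqF lambda0) gt_eqF.
  rewrite (_ : p (u k) = lambda / (s * u k ^+ 6) * (z k ^+ 3 / 6)).
    by rewrite ler_pM2l//; have := sin_ge3 zk; lra.
  rewrite /p zE /r; field.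
  by rewrite (gt_eqF (u_gt0 k)) (gt_eqF lambda0) gt_eqF.
- rewrite [X in _ --> X](_ : _ = q 0); last by rewrite /q /p !expr0n/=; ring.
  by apply: (@comp_cvg q) => x; exact: ex_derive.
- rewrite [X in _ --> X](_ : _ = p 0); last by rewrite /p !expr0n/=; ring.
  by apply: (@comp_cvg p) => x; exact: ex_derive.
Unshelve. all: end_near. Qed.

(** lambda drift = (lambda / theta) (1 - cos z) is lambda theta m^2 / 2 up to a
    vanishing term, and replacing m by sg^4 / lambda costs only O (1 / sg). *)
Lemma drift_cvg :
  lambda * drift (m k) (theta k) 0 - theta k * sg k ^+ 8 / (2 * lambda)
  @[k --> \oo] --> 0.
Proof.
pose p (x : R) := s / (2 * lambda) * (4 * c * x + 4 * c ^+ 2 * x ^+ 4).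
pose q (x : R) := p x -
  s ^+ 3 / (24 * lambda ^+ 3) * x ^+ 2 * (1 + 2 * c * x ^+ 3) ^+ 4.
have E k : lambda * drift (m k) (theta k) 0 - theta k * sg k ^+ 8 / (2 * lambda) =
    lambda / (s * u k ^+ 6) * (1 - cos (z k)) - s / (2 * lambda * u k ^+ 2).
  have -> : u k ^+ 6 = (sg k ^+ 6)^-1 by rewrite exprVn.
  have -> : u k ^+ 2 = (sg k ^+ 2)^-1 by rewrite exprVn.
  rewrite /drift mulr0 cos0 -/(z k) /theta; field.
  by rewrite !gt_eqF ?exprn_gt0.
have L k : 0 < lambda / (s * u k ^+ 6) by rewrite divr_gt0// mulr_gt0 ?exprn_gt0.
apply: (@squeeze_cvgr _ _ _ _ (q \o u) (p \o u)).
- near=> k; have zk : 0 <= z k by near: k; exact: near_z_ge0.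
  rewrite E /=; apply/andP; split.
    rewrite (_ : q (u k) = lambda / (s * u k ^+ 6) * (z k ^+ 2 / 2 - z k ^+ 4 / 24)
       - s / (2 * lambda * u k ^+ 2)).
      by rewrite lerB// ler_pM2l//; have := cos_le4 zk; lra.
    rewrite /q /p zE /r; field.
    by rewrite (gt_eqF (u_gt0 k)) (gt_eqF lambda0) gt_eqF.
  rewrite (_ : p (u k) = lambda / (s * u k ^+ 6) * (z k ^+ 2 / 2)
       - s / (2 * lambda * u k ^+ 2)).
    by rewrite lerB// ler_pM2l//; have := cos_ge2 zk; lra.
  rewrite /p zE /r; field.
  by rewrite (gt_eqF (u_gt0 k)) (gt_eqF lambda0) gt_eqF.
- rewrite [X in _ --> X](_ : _ = q 0); last by rewrite /q /p !expr0n/=; ring.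
  by apply: (@comp_cvg q) => x; exact: ex_derive.
- rewrite [X in _ --> X](_ : _ = p 0); last by rewrite /p !expr0n/=; ring.
  by apply: (@comp_cvg p) => x; exact: ex_derive.
Unshelve. all: end_near. Qed.

Lemma final_cos_cvg :
  final_cos lambda (m k) (theta k) (beta - theta k * sg k ^+ 8 / (2 * lambda)) 0 0
  @[k --> \oo] --> cos beta * expR (- (s ^+ 2 / (6 * lambda ^+ 2))).
Proof.
rewrite [X in _ --> X]mulrC; apply: cvgM.
  under eq_fun do rewrite mulNr.
  apply: (@continuous_cvg _ _ _ _ _ (fun k => - (lambda * damping (m k) (theta k) 0)) expR).
    exact: continuous_expR.
  by apply: cvgN; exact: damping_cvg.
apply: (@continuous_cvg _ _ _ _ _ (fun k => theta k * 0 + lambda * drift (m k) (theta k) 0 +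
    (beta - theta k * sg k ^+ 8 / (2 * lambda))) cos).
  exact: continuous_cos.
rewrite -[X in _ --> X]addr0.
rewrite [X in X @ _](_ : _ = (fun k => beta +
  (lambda * drift (m k) (theta k) 0 - theta k * sg k ^+ 8 / (2 * lambda)))).
  by apply: cvgD; [exact: cvg_cst|exact: drift_cvg].
by apply/funext => k; ring.
Qed.

End martingale_limit.

Section sequence_clt.
Context (R : realType) d d' (T : measurableType d) (T' : measurableType d').
Variables (P : probability T R) (P' : probability T' R).
Variables (lambda : R) (X : nat -> {RV P >-> R}) (W' : {RV P' >-> R}).
Hypothesis lambda0 : 0 < lambda.
Hypothesis indep : mutually_independent X.
Hypothesis lawX : forall k, has_law (X k) (exponential_prob lambda).
Hypothesis lawW' :
  has_law W' (normal_prob 0 (Num.sqrt (1 / (3 * lambda ^+ 2)))).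

Lemma limit_cos_transform (s a : R) :
  \int[P']_w cos (s * (W' w - a)) =
  cos (- (s * a)) * expR (- (s ^+ 2 / (6 * lambda ^+ 2))).
Proof.
pose sd := Num.sqrt (1 / (3 * lambda ^+ 2)).
have v0 : 0 < 1 / (3 * lambda ^+ 2) by rewrite divr_gt0// mulr_gt0 ?exprn_gt0.
have sd2 : sd ^+ 2 = 1 / (3 * lambda ^+ 2) by rewrite sqr_sqrtr// ltW.
have sd0 : sd != 0 by rewrite gt_eqF// sqrtr_gt0.
have mcos : measurable_fun setT (fun x : R => cos (s * (x - a))).
  apply: measurable_cosM; apply: measurable_funM => //.
  exact: measurable_funB.
rewrite (Rintegral_RV_density (measurable_normal_pdf 0 sd) (normal_pdf_ge0 0 sd)
  lawW' mcos (fun x => normr_cos_le1 _)).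
under eq_Rintegral do rewrite mulrBr.
rewrite normal_cos_transform// sd2; congr (_ * expR (- _)).
by field; rewrite gt_eqF.
Qed.

Definition truncated_record_sum (m : R) (n : nat) (w : T) : R :=
  (record_chain X m n w).2.

Lemma measurable_truncated_record_sum m n :
  measurable_fun setT (truncated_record_sum m n).
Proof. exact: measurableT_comp measurable_snd (measurable_record_chain X m n). Qed.

HB.instance Definition _ m n :=
  isMeasurableFun.Build _ _ T R (truncated_record_sum m n)
    (measurable_truncated_record_sum m n).

(** The hypothesis on n says that some of the first n lifetimes exceed the level
    with overwhelming probability, so that they exhaust the records below it. *)
Lemma truncated_record_cdf_cvg (sg : nat -> R) (c : R) (n : nat -> nat) (x : R) :
  (forall k, 0 < sg k) -> sg k @[k --> \oo] --> +oo ->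
  (forall k, 0 < sg k ^+ 4 + 2 * c * sg k) ->
  (forall k, sg k <= (n k)%:R * expR (- (sg k ^+ 4 + 2 * c * sg k))) ->
  {for x, continuous (cdf W')} ->
  pr P [set w | center_scale (sg k ^+ 8 / (2 * lambda)) (sg k ^+ 6)
    (truncated_record_sum ((sg k ^+ 4 + 2 * c * sg k) / lambda) (n k)) w <= x]
    @[k --> \oo] --> pr P' [set w | W' w <= x].
Proof.
move=> sg0 sgoo m0 nm cont.
pose m k := (sg k ^+ 4 + 2 * c * sg k) / lambda.
pose Y_ k : {RV P >-> R} := center_scale (sg k ^+ 8 / (2 * lambda)) (sg k ^+ 6)
  (truncated_record_sum (m k) (n k)).
apply: (@levy_cdf R _ _ _ _ P P' Y_ W' _ x cont) => s a s0.
rewrite limit_cos_transform.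
have E k : \int[P]_w cos (s * (Y_ k w - a)) =
    \int[P]_w cos (s / sg k ^+ 6 * (record_chain X (m k) (n k) w).2 +
      (- (s * a) - s / sg k ^+ 6 * sg k ^+ 8 / (2 * lambda))).
  apply: eq_Rintegral => w _; congr cos.
  rewrite /Y_/= /center_scale /truncated_record_sum; field.
  by rewrite (gt_eqF lambda0) (gt_eqF (sg0 k)).
have := @final_cos_cvg R lambda s c (- (s * a)) lambda0 s0 sg sg0 sgoo.
set M := (fun k => final_cos _ _ _ _ _ _) => lim.
pose I k := \int[P]_w cos (s / sg k ^+ 6 * (record_chain X (m k) (n k) w).2 +
      (- (s * a) - s / sg k ^+ 6 * sg k ^+ 8 / (2 * lambda))).
suff diff : I k - M k @[k --> \oo] --> 0.
  have -> : (fun k => \int[P]_w cos (s * (Y_ k w - a))) =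
      (fun k => M k + (I k - M k)).
    by apply/funext => k; rewrite E -/(I k) addrC subrK.
  have h := cvgD lim diff; rewrite addr0 in h; exact: h.
apply: norm_cvg0.
apply: (@squeeze_cvgr _ _ _ _ (cst 0) (fun k => 2 * expR (- 1 * sg k))).
- near=> k; rewrite normr_ge0/= /I /M /m.
  have mk0 : 0 < m k by rewrite divr_gt0.
  have th0 : 0 < s / sg k ^+ 6 by rewrite divr_gt0 ?exprn_gt0.
  apply: (le_trans (record_chain_cos lambda0 indep lawX mk0 _ _ th0)).
  rewrite ler_pM2l// ler_expR mulN1r lerN2.
  have -> : - lambda * m k = - (sg k ^+ 4 + 2 * c * sg k).
    by rewrite /m; field; rewrite gt_eqF.
  exact: nm.
- exact: cvg_cst.
- rewrite -[0](mulr0 2); apply: cvgMl_tmp.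
  exact: ((cvg_pinftyP _ _).1 (cvgr_expRM ltr01) _ sgoo).
Unshelve. all: end_near. Qed.

Let not_positive : set T := [set w | exists k, X k w <= 0].

Let measurable_not_positive : measurable not_positive.
Proof.
rewrite (_ : not_positive = \bigcup_k [set w | X k w <= 0]).
  by apply: bigcupT_measurable => k; exact: measurable_RV_le.
by apply/seteqP; split => w [k]; exists k.
Qed.

Let measurable_exists_gt n m :
  measurable [set w | exists2 k, (k < n)%N & m < X k w].
Proof.
rewrite (_ : mkset _ = \bigcup_(j in [set j | (j < n)%N]) [set w | m < X j w]).
  by apply: bigcup_measurable => j _; exact: measurable_RV_gt.
by apply/seteqP; split => w [j ? ?]; exists j.
Qed.

Let measurable_positive_sum_le n (t : R) :
  measurable [set w | positive_sum X n w <= t].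
Proof.
have ms : measurable_fun setT (positive_sum X n).
  apply: measurable_chain.
  by apply: measurable_funD => //; exact: measurable_maxr.
rewrite -[X in measurable X]setTI.
have := @measurable_fun_ler _ _ _ setT (positive_sum X n) (cst t).
by move=> /(_ _ _ measurableT [set true]); apply.
Qed.

Let measurable_lt_mfun (f g : {RV P >-> R}) : measurable [set w | f w < g w].
Proof.
rewrite -[X in measurable X]setTI.
have := @measurable_fun_ltr _ _ _ setT f g.
by move=> /(_ _ _ measurableT [set true]); apply.
Qed.

(** If the first n lifetimes are all at most 2 sg^4 / lambda, they are over by
    time t = exp (sg^4); a union bound controls the exception. *)
Lemma pr_record_time_lt (sg : R) (n : nat) : 2 <= sg ->
  2 * sg ^+ 4 / lambda <= expR sg ->
  n%:R <= expR (sg ^+ 4 - sg) ->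
  pr P [set w | record_time X (expR (sg ^+ 4)) w <
    truncated_record_sum ((sg ^+ 4 - 2 * sg) / lambda) n w] <= expR (- sg).
Proof.
move=> sg2 sgl hn.
have sg0 : 0 < sg by lra.
pose m' := 2 * sg ^+ 4 / lambda.
have m'0 : 0 < m' by rewrite divr_gt0// mulr_gt0// exprn_gt0.
pose B := [set w | exists2 k, (k < n)%N & m' < X k w].
apply: (@le_trans _ _ (pr P not_positive + pr P B)).
  apply: pr_leU; [exact: measurable_lt_mfun|exact: measurable_not_positive|
    exact: measurable_exists_gt|].
  move=> w /=; apply: contraPP => /not_orP[npos nB].
  have pos k : 0 < X k w.
    by rewrite ltNge; apply/negP => h; apply: npos; exists k.
  have Xm k : (k < n)%N -> X k w <= m'.
    by move=> kn; rewrite leNgt; apply/negP => h; apply: nB; exists k.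
  apply/negP; rewrite -leNgt.
  apply: (le_trans (record_chain_le_record_sum pos _ _)).
  apply: record_sum_le_record_time => //.
  apply: (le_trans (arrival_time_le Xm)).
  apply: (@le_trans _ _ (expR (sg ^+ 4 - sg) * expR sg)).
    by rewrite ler_pM// ltW.
  by rewrite -expRD subrK.
rewrite (pr_exists_le0 lawX) add0r.
apply: (le_trans (pr_exists_gt lawX n m'0)).
apply: (@le_trans _ _ (expR (sg ^+ 4 - sg) * expR (- lambda * m'))).
  by rewrite ler_wpM2r ?expR_ge0.
rewrite -expRD ler_expR.
have -> : - lambda * m' = - (2 * sg ^+ 4) by rewrite /m'; field; rewrite gt_eqF.
have := exprn_ge0 4 (ltW sg0); lra.
Qed.

(** Two exceptions: the first n2 lifetimes are over by time t, or one of them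
    exceeds the level.  Outside these, W_t is at most the sum of the records
    among the first n2 lifetimes, all of which are counted by the chain. *)
Lemma pr_record_time_gt (sg kappa : R) (n2 n3 : nat) : 2 <= sg ->
  (forall n, (lambda / (lambda + 1)) ^+ n = expR (- (n%:R * kappa))) ->
  1 <= kappa * expR sg ->
  (n2 <= n3)%N -> expR (sg ^+ 4 + sg) <= n2%:R <= expR (sg ^+ 4 + sg) + 1 ->
  pr P [set w | truncated_record_sum ((sg ^+ 4 + 2 * sg) / lambda) n3 w <
    record_time X (expR (sg ^+ 4)) w] <=
  expR (1 - kappa * expR sg) + 2 * expR (- sg).
Proof.
move=> sg2 rho ksg n23 /andP[n2l n2u].
have sg0 : 0 < sg by lra.
have sg40 : 0 <= sg ^+ 4 by rewrite exprn_ge0// ltW.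
set m := _ / lambda.
have m0 : 0 < m by rewrite divr_gt0//; lra.
set t := expR (sg ^+ 4).
have t1 : 1 <= t by rewrite -expR0 ler_expR.
pose B := [set w | exists2 k, (k < n2)%N & m < X k w].
pose S := [set w | positive_sum X n2 w <= t].
apply: (@le_trans _ _ (pr P not_positive + (pr P S + pr P B))).
  have mSB : measurable (S `|` B).
    by apply: measurableU; [exact: measurable_positive_sum_le|exact: measurable_exists_gt].
  apply: (@le_trans _ _ (pr P not_positive + pr P (S `|` B))).
    apply: pr_leU; [exact: measurable_lt_mfun|exact: measurable_not_positive|exact: mSB|].
    move=> w /=; apply: contraPP => /not_orP[npos /not_orP[nS nB]].
    have pos k : 0 < X k w.
      by rewrite ltNge; apply/negP => h; apply: npos; exists k.
    have Xm k : (k < n2)%N -> X k w <= m.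
      by move=> kn; rewrite leNgt; apply/negP => h; apply: nB; exists k.
    apply/negP; rewrite -leNgt.
    apply: le_trans (record_chain_nondecreasing pos m n23).
    rewrite (record_chain_eq_record_sum pos Xm).
    apply: record_time_le_record_sum => //.
    rewrite (arrival_time_positive_sum pos) ltNge; exact/negP.
  rewrite lerD2l; apply: pr_leU => //.
    exact: measurable_positive_sum_le.
  exact: measurable_exists_gt.
rewrite (pr_exists_le0 lawX) add0r; apply: lerD.
  apply: (le_trans (pr_positive_sum_le lambda0 indep lawX _ _)).
  rewrite rho -expRD ler_expR.
  have k0 : 0 <= kappa.
    by rewrite -(pmulr_lge0 _ (expR_gt0 sg)) (le_trans _ ksg).
  have : t * (kappa * expR sg) <= n2%:R * kappa.
    by rewrite mulrCA mulrC ler_wpM2r// -expRD.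
  have : 0 <= (t - 1) * (kappa * expR sg - 1) by rewrite mulr_ge0 ?subr_ge0.
  lra.
apply: (le_trans (pr_exists_gt lawX n2 m0)).
have -> : - lambda * m = - (sg ^+ 4 + 2 * sg) by rewrite /m; field; rewrite gt_eqF.
apply: (@le_trans _ _ ((expR (sg ^+ 4 + sg) + 1) * expR (- (sg ^+ 4 + 2 * sg)))).
  by rewrite ler_wpM2r ?expR_ge0.
have -> : 2 * expR (- sg) = expR (- sg) + expR (- sg) by ring.
by rewrite mulrDl mul1r -expRD; apply: lerD; rewrite ler_expR; lra.
Qed.

(** With t = exp (sg^4), the first n1 lifetimes end before t but some exceed the
    lower level, the first n2 end after t and all stay below the upper level, and
    some of the first n3 >= n2 exceed the upper level, with high probability. *)
Lemma record_time_cdf_cvg (sg : nat -> R) (x : R) :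
  (forall k, 2 <= sg k) -> sg k @[k --> \oo] --> +oo ->
  {for x, continuous (cdf W')} ->
  pr P [set w | center_scale (sg k ^+ 8 / (2 * lambda)) (sg k ^+ 6)
    (record_time X (expR (sg k ^+ 4))) w <= x]
    @[k --> \oo] --> pr P' [set w | W' w <= x].
Proof.
move=> sg2 sgoo cont.
have sg0 k : 0 < sg k by have := sg2 k; lra.
have sg4 k : 8 * sg k <= sg k ^+ 4.
  have -> : sg k ^+ 4 = sg k ^+ 3 * sg k by ring.
  rewrite ler_pM2r//.
  have -> : 8 = 2 ^+ 3 :> R by ring.
  by rewrite lerXn2r// nnegrE ltW.
pose rho := lambda / (lambda + 1).
have l1 : 0 < lambda + 1 by rewrite addr_gt0.
have rho0 : 0 < rho by rewrite divr_gt0.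
have rho1 : rho < 1 by rewrite ltr_pdivrMr// mul1r ltrDl.
pose kappa := - ln rho.
have kappa0 : 0 < kappa by rewrite oppr_gt0 ln_lt0// rho0 rho1.
have rhoE n : rho ^+ n = expR (- (n%:R * kappa)).
  by rewrite mulrN opprK expRM_natl lnK// posrE.
pose n1 k := Num.truncn (expR (sg k ^+ 4 - sg k)).
pose n2 k := (Num.truncn (expR (sg k ^+ 4 + sg k))).+1.
pose n3 k := (Num.truncn (expR (sg k ^+ 4 + 3 * sg k))).+1.
have n1P k : (n1 k)%:R <= expR (sg k ^+ 4 - sg k) < (n1 k).+1%:R.
  by rewrite truncn_itv// expR_ge0.
have n2P k : (n2 k).-1%:R <= expR (sg k ^+ 4 + sg k) < (n2 k)%:R.
  by rewrite truncn_itv// expR_ge0.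
have n3P k : (n3 k).-1%:R <= expR (sg k ^+ 4 + 3 * sg k) < (n3 k)%:R.
  by rewrite truncn_itv// expR_ge0.
have n23 k : (n2 k <= n3 k)%N.
  rewrite ltnS; apply: le_truncn; rewrite ler_expR.
  by have := sg0 k; lra.
have expR_ge_id (y : R) : y <= expR y by have := @expR_ge1Dx R y; lra.
have low_pos k : 0 < sg k ^+ 4 + 2 * (- 1) * sg k.
  by have := sg4 k; have := sg0 k; lra.
have up_pos k : 0 < sg k ^+ 4 + 2 * 1 * sg k.
  by have := sg4 k; have := sg0 k; lra.
have low_n k : sg k <= (n1 k)%:R * expR (- (sg k ^+ 4 + 2 * (- 1) * sg k)).
  have /andP[_] := n1P k; rewrite -natr1 -ltrBlDr => /ltW h.
  apply: (@le_trans _ _ ((expR (sg k ^+ 4 - sg k) - 1) *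
    expR (- (sg k ^+ 4 + 2 * (- 1) * sg k)))); last first.
    by rewrite ler_wpM2r ?expR_ge0.
  rewrite mulrBl mul1r -expRD.
  have -> : sg k ^+ 4 - sg k + - (sg k ^+ 4 + 2 * (- 1) * sg k) = sg k by ring.
  have := @expR_ge1Dx R (sg k).
  have : expR (- (sg k ^+ 4 + 2 * (- 1) * sg k)) <= 1.
    by rewrite -[leRHS]expR0 ler_expR oppr_le0 ltW.
  lra.
have up_n k : sg k <= (n3 k)%:R * expR (- (sg k ^+ 4 + 2 * 1 * sg k)).
  have /andP[_ /ltW h] := n3P k.
  apply: (@le_trans _ _ (expR (sg k ^+ 4 + 3 * sg k) *
    expR (- (sg k ^+ 4 + 2 * 1 * sg k)))); last first.
    by rewrite ler_wpM2r ?expR_ge0.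
  rewrite -expRD.
  have -> : sg k ^+ 4 + 3 * sg k + - (sg k ^+ 4 + 2 * 1 * sg k) = sg k by ring.
  exact: expR_ge_id.
have lower := truncated_record_cdf_cvg sg0 sgoo low_pos low_n cont.
have upper := truncated_record_cdf_cvg sg0 sgoo up_pos up_n cont.
have exp_cvg (e : R) : 0 < e -> expR (- e * sg k) @[k --> \oo] --> 0.
  by move=> e0; exact: ((cvg_pinftyP _ _).1 (cvgr_expRM e0) _ sgoo).
(* The fifth power of exp (y) >= y at y = sg / 5 beats sg^4; K hides a numeral. *)
have [K K0 KE] : exists2 K : R, 0 < K & 5 ^+ 5 = K.
  by exists (5 ^+ 5) => //; exact: exprn_gt0.
have near_large : \forall k \near \oo,
    [/\ 2 * sg k ^+ 4 / lambda <= expR (sg k) & 1 <= kappa * expR (sg k)].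
  near=> k; split; last first.
    have k1 : kappa^-1 <= sg k by near: k; exact: (cvgryPge _).1.
    rewrite -ler_pdivrMl// mulr1.
    exact: le_trans k1 (expR_ge_id _).
  have k1 : 2 * K / lambda <= sg k by near: k; exact: (cvgryPge _).1.
  apply: (@le_trans _ _ ((sg k / 5) ^+ 5)).
    rewrite expr_div_n KE [sg k ^+ 5]exprSr.
    have -> : 2 * sg k ^+ 4 / lambda = sg k ^+ 4 * (2 * K / lambda) / K.
      by field; rewrite (gt_eqF lambda0) (gt_eqF K0).
    by rewrite ler_pM2r ?invr_gt0// ler_pM2l// exprn_gt0.
  have -> : expR (sg k) = expR (sg k / 5) ^+ 5.
    by rewrite -expRM_natl; congr expR; field.
  rewrite lerXn2r ?nnegrE ?expR_ge0//.
  by rewrite divr_ge0// ltW.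
pose Z k : {RV P >-> R} := center_scale (sg k ^+ 8 / (2 * lambda)) (sg k ^+ 6)
  (record_time X (expR (sg k ^+ 4))).
pose Yl k : {RV P >-> R} := center_scale (sg k ^+ 8 / (2 * lambda)) (sg k ^+ 6)
  (truncated_record_sum ((sg k ^+ 4 + 2 * (- 1) * sg k) / lambda) (n1 k)).
pose Yu k : {RV P >-> R} := center_scale (sg k ^+ 8 / (2 * lambda)) (sg k ^+ 6)
  (truncated_record_sum ((sg k ^+ 4 + 2 * 1 * sg k) / lambda) (n3 k)).
have center_scale_mono k (f g : T -> R) w : f w <= g w ->
    center_scale (sg k ^+ 8 / (2 * lambda)) (sg k ^+ 6) f w <=
    center_scale (sg k ^+ 8 / (2 * lambda)) (sg k ^+ 6) g w.
  by move=> fg; rewrite /center_scale ler_pM2l ?invr_gt0 ?exprn_gt0// lerB.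
pose eps k := expR 1 * expR (- kappa * sg k) + 2 * expR (- 1 * sg k).
apply: (@squeeze_cvgr _ _ _ _ (fun k => pr P [set w | Yu k w <= x] - eps k)
  (fun k => pr P [set w | Yl k w <= x] + expR (- 1 * sg k))).
- near=> k; have [c1 c2] : [/\ 2 * sg k ^+ 4 / lambda <= expR (sg k) &
      1 <= kappa * expR (sg k)] by near: k.
  apply/andP; split.
    rewrite lerBlDr.
    apply: (@le_trans _ _ (pr P [set w | Z k w <= x] + pr P [set w |
        truncated_record_sum ((sg k ^+ 4 + 2 * 1 * sg k) / lambda) (n3 k) w <
        record_time X (expR (sg k ^+ 4)) w])).
      apply: pr_leU; [exact: measurable_RV_le|exact: measurable_RV_le|
        exact: measurable_lt_mfun|].
      move=> w /= wx.
      have [h|h] := leP (record_time X (expR (sg k ^+ 4)) w)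
        (truncated_record_sum ((sg k ^+ 4 + 2 * 1 * sg k) / lambda) (n3 k) w).
        by left; apply: le_trans wx; exact: center_scale_mono.
      by right.
    rewrite lerD2l mulr1.
    have n2P' : expR (sg k ^+ 4 + sg k) <= (n2 k)%:R <= expR (sg k ^+ 4 + sg k) + 1.
      have /andP[h1 h2] := n2P k; rewrite (ltW h2)/=.
      by rewrite /n2 -natr1 lerD2r.
    apply: (le_trans (pr_record_time_gt (sg2 k) rhoE c2 (n23 k) n2P')).
    by rewrite /eps mulN1r lerD2r -expRD ler_expR lerD2l [- kappa * _]mulNr lerN2 ler_pM2l.
  apply: (@le_trans _ _ (pr P [set w | Yl k w <= x] + pr P [set w |
        record_time X (expR (sg k ^+ 4)) w <
        truncated_record_sum ((sg k ^+ 4 + 2 * (- 1) * sg k) / lambda) (n1 k) w])).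
    apply: pr_leU; [exact: measurable_RV_le|exact: measurable_RV_le|
      exact: measurable_lt_mfun|].
    move=> w /= wx.
    have [h|h] := leP
      (truncated_record_sum ((sg k ^+ 4 + 2 * (- 1) * sg k) / lambda) (n1 k) w)
      (record_time X (expR (sg k ^+ 4)) w).
      by left; apply: le_trans wx; exact: center_scale_mono.
    by right.
  rewrite lerD2l mulN1r.
  have -> : sg k ^+ 4 + 2 * (- 1) * sg k = sg k ^+ 4 - 2 * sg k by ring.
  by apply: pr_record_time_lt => //; have /andP[] := n1P k.
- rewrite -[X in _ --> X]subr0; apply: cvgB => //.
  rewrite -[X in _ --> X]addr0 /eps; apply: cvgD.
    by rewrite -[X in _ --> X](mulr0 (expR 1)); apply: cvgMl_tmp; exact: exp_cvg.
  by rewrite -[X in _ --> X](mulr0 2); apply: cvgMl_tmp; exact: exp_cvg.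
- by rewrite -[X in _ --> X]addr0; apply: cvgD => //; exact: exp_cvg.
Unshelve. all: end_near. Qed.

End sequence_clt.

Theorem corollary1p4 (R : realType) (d d' : measure_display)
    (T : measurableType d) (T' : measurableType d')
    (P : probability T R) (P' : probability T' R)
    (lambda : R) (X : nat -> {RV P >-> R}) (W' : {RV P' >-> R}) :
  0 < lambda ->
  mutually_independent X ->
  (forall k, has_law (X k) (exponential_prob lambda)) ->
  has_law W' (normal_prob 0 (Num.sqrt (1 / (3 * lambda ^+ 2)))) ->
  cvg_in_distribution (+oo%R : set_system R)
    (fun t : R => center_scale (ln t ^+ 2 / (2 * lambda)) (ln t `^ (3 / 2))
                    (record_time X t) : {RV P >-> R})
    W'.
Proof.
move=> lambda0 indep lawX lawW' x cont.
rewrite cdf_pr; under eq_fun do rewrite cdf_pr.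
apply: cvg_EFin; first exact: nearW.
apply/cvg_pinftyP => t too.
(* The maximum only matters for finitely many terms. *)
pose sg k := Num.max 2 (Num.sqrt (Num.sqrt (ln (t k)))).
have sg2 k : 2 <= sg k by rewrite le_max lexx.
have large A : \forall k \near \oo, expR (Num.max 2 A ^+ 4) <= t k.
  exact: (cvgryPge _).1.
have sgE : \forall k \near \oo, ln (t k) = sg k ^+ 4.
  near=> k.
  have tk : expR (Num.max 2 2 ^+ 4) <= t k by near: k.
  have t0 : 0 < t k by apply: lt_le_trans tk; exact: expR_gt0.
  have lnt : 2 ^+ 4 <= ln (t k).
    by rewrite -ler_expR lnK ?posrE// -[X in expR (X ^+ _)](maxxx 2).
  have lnt0 : 0 <= ln (t k) by apply: le_trans lnt; rewrite exprn_ge0.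
  rewrite /sg (max_idPr _).
    by rewrite (exprM _ 2 2) !sqr_sqrtr// sqrtr_ge0.
  have -> : 2 = Num.sqrt (Num.sqrt (2 ^+ 4)) :> R.
    by rewrite (exprM _ 2 2) sqrtr_sqr ger0_norm ?exprn_ge0// sqrtr_sqr ger0_norm.
  by rewrite !ler_wsqrtr.
have sgoo : sg k @[k --> \oo] --> +oo.
  apply/cvgryPge => A; near=> k.
  have tk : expR (Num.max 2 A ^+ 4) <= t k by near: k.
  have t0 : 0 < t k by apply: lt_le_trans tk; exact: expR_gt0.
  have lnE : ln (t k) = sg k ^+ 4 by near: k.
  have : Num.max 2 A ^+ 4 <= sg k ^+ 4 by rewrite -lnE -ler_expR lnK ?posrE.
  rewrite ler_pXn2r// ?nnegrE.
  - by rewrite ge_max => /andP[].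
  - by rewrite le_max ler0n.
  - by apply: le_trans (sg2 k).
apply: cvg_trans (record_time_cdf_cvg lambda0 indep lawX lawW' sg2 sgoo cont).
apply: near_eq_cvg; near=> k.
have lnE : ln (t k) = sg k ^+ 4 by near: k.
have t0 : 0 < t k.
  have tk : expR (Num.max 2 2 ^+ 4) <= t k by near: k; exact: large.
  by apply: lt_le_trans tk; exact: expR_gt0.
have sg0 : 0 < sg k by apply: lt_le_trans (sg2 k).
have tE : expR (sg k ^+ 4) = t k by rewrite -lnE lnK ?posrE.
have scaleE : (sg k ^+ 4) `^ (3 / 2) = sg k ^+ 6.
  rewrite /powR gt_eqF ?exprn_gt0// lnXn//.
  have -> : 3 / 2 * (ln (sg k) *+ 4) = 6%:R * ln (sg k) by field.
  by rewrite expRM_natl lnK// posrE.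
by rewrite /= lnE scaleE -exprM tE.
Unshelve. all: end_near. Qed.
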